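(* Let $k\ge2$, $M>0$, $\sigma>0$, let $m_1,\dots,m_k\in\mathbb R^2$ be distinct, and let $\theta_1,\dots,\theta_k\geq 0$ with $\sum_i\theta_i=1$. Let $P$ be the quasi-Gaussian mixture distribution on $\mathbb R^2$ with density $$f(x)=\sum_{i=1}^k\frac{\theta_i}{2\pi\sigma^2N_i}\,e^{-\|x-m_i\|^2/(2\sigma^2)}\,\mathbf 1_{\mathcal B(0,M)}(x),$$ where $N_i=\int_{\mathcal B(0,M)}\frac1{2\pi\sigma^2}e^{-\|x-m_i\|^2/(2\sigma^2)}dx$ is the normalization constant of the $i$-th truncated Gaussian component. Let $\eta=1-\min_{i}N_i$, $\tilde B=\inf_{i\ne j}\|m_i-m_j\|$, $\theta_{\min}=\min_i\theta_i$, $\theta_{\max}=\max_i\theta_i$, and assume that $\mathcal B(m_i,\tilde B/3)\subset\mathcal B(0,M)$ for all $i=1,\dots,k$. If $$\frac{\theta_{\min}}{\theta_{\max}}\ \ge\ \frac{2048\,k}{(1-\eta)\tilde B}\max\left(\frac{\sigma^2}{\tilde B\left(1-e^{-\tilde B^2/(2048\sigma^2)}\right)},\ \frac{kM^3}{7\sigma^2\left(e^{\tilde B^2/(32\sigma^2)}-1\right)}\right),$$ then $P$ satisfies a margin condition (for $k$-point codebooks) with radius $\frac{\tilde B}8$.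
   Context: Here $\mathcal H=\mathbb R^2$ with Euclidean norm and $\mathcal B(a,r)$ is the closed ball. Codebooks are $\mathbf c=(c_1,\dots,c_k)\in(\mathbb R^2)^k$, where $k$ is the number of components of the mixture. $P$ is called $M$-bounded if its support is included in $\mathcal B(0,M)$. Risk: $R(\mathbf c)=\int\min_j\|x-c_j\|^2dP(x)$. $\mathcal M$ is the set of optimal codebooks, i.e. minimizers of $R$ over $(\mathbb R^2)^k$. Voronoi cells: $V_i(\mathbf c)=\{x:\ \forall j\ne i,\ \|x-c_i\|\le\|x-c_j\|\}$. $$B=\inf_{\mathbf c^*\in\mathcal M,\ i\ne j}\|c_i^*-c_j^*\|,\qquad p_{\min}=\inf_{\mathbf c^*\in\mathcal M,\ i=1,\dots,k}P(V_i(\mathbf c^* )).$$ For $\mathbf c^*\in\mathcal M$, $N_{\mathbf c^*}=\bigcup_{i\ne j}V_i(\mathbf c^* )\cap V_j(\mathbf c^* )$. For a set $A$, $\mathcal B(A,t)=\bigcup_{a\in A}\mathcal B(a,t)$. $p(t)=\sup_{\mathbf c^*\in\mathcal M}P(\mathcal B(N_{\mathbf c^*},t))$. Margin condition with radius $r_0>0$: (i) $P$ is $M$-bounded; (ii) for all $0\le t\le r_0$, $p(t)\le\frac{B\,p_{\min}}{128M^2}\,t$. *)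

(* Defs.v *)
From HB Require Import structures.
From mathcomp Require Import all_boot all_order all_algebra.
From mathcomp Require Import all_classical all_reals all_analysis.

Set Implicit Arguments.
Unset Strict Implicit.
Unset Printing Implicit Defensive.

Import Order.TTheory GRing.Theory Num.Theory.
Import numFieldNormedType.Exports.

Local Open Scope classical_set_scope.
Local Open Scope ring_scope.

(* [measurableTypeR R] is [R] with the Borel sigma-algebra on which
   [lebesgue_measure] is defined. *)
Notation plane R := (measurableTypeR R * measurableTypeR R)%type.

Section plane.
Context {R : realType}.
Implicit Types (x y a : plane R) (A : set (plane R)).

(* The library norm on [R * R] is the sup norm, hence this definition. *)
Definition enorm x : R := Num.sqrt (x.1 ^+ 2 + x.2 ^+ 2).

(* [closed_ball] of the library is for the sup norm, too. *)
Definition eball a (r : R) : set (plane R) := [set x | enorm (x - a) <= r].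

Definition ethickening A (r : R) : set (plane R) := \bigcup_(a in A) eball a r.

Definition lebesgue2 : {measure set (plane R) -> \bar R} :=
  (@lebesgue_measure R \x @lebesgue_measure R)%E.

Definition measure_support (P : {measure set (plane R) -> \bar R}) : set (plane R) :=
  [set x | forall U, open U -> U x -> (0 < P U)%E].

Definition has_density (P : {measure set (plane R) -> \bar R}) (f : plane R -> R) : Prop :=
  forall A, measurable A -> P A = (\int[lebesgue2]_(x in A) (f x)%:E)%E.

End plane.

Definition codebook (R : realType) (k : nat) : Type := 'I_k -> plane R.

Section quantization.
Context {R : realType} {k : nat}.
Variable P : probability (plane R) R.
Implicit Types (c : codebook R k) (i j : 'I_k).

(* Here and below, for [0 < k], the [inf] or [sup] of a range indexed by ['I_k]
   is the minimum or maximum of a nonempty finite family. *)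
Definition risk c : \bar R :=
  (\int[P]_x (inf (range (fun j => enorm (x - c j) ^+ 2)))%:E)%E.

Definition optimal_codebooks : set (codebook R k) :=
  [set c | forall c', (risk c <= risk c')%E].

Definition voronoi c i : set (plane R) :=
  [set x | forall j, j != i -> enorm (x - c i) <= enorm (x - c j)].

Definition frontier c : set (plane R) :=
  [set x | exists i j, i != j /\ (voronoi c i `&` voronoi c j) x].

Definition optimal_separation : \bar R :=
  ereal_inf [set b | exists c i j,
    [/\ optimal_codebooks c, i != j & b = (enorm (c i - c j))%:E]].

Definition min_cell_mass : \bar R :=
  ereal_inf [set b | exists c i,
    optimal_codebooks c /\ b = P (voronoi c i)].

Definition frontier_mass (t : R) : \bar R :=
  ereal_sup [set P (ethickening (frontier c) t) | c in optimal_codebooks].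

Definition bounded_by (M : R) : Prop := measure_support P `<=` eball 0 M.

Definition margin_condition (M r0 : R) : Prop :=
  [/\ 0 < r0, bounded_by M &
    forall t : R, 0 <= t <= r0 ->
      (frontier_mass t <= optimal_separation * min_cell_mass
                            * ((128 * M ^+ 2)^-1 * t)%:E)%E].

End quantization.

Arguments margin_condition {R} k P M r0.

Section quasi_gaussian_mixture.
Context {R : realType} {k : nat}.
Variables (M sigma : R) (m : 'I_k -> plane R) (theta : 'I_k -> R).

Definition gauss2 (a x : plane R) : R :=
  (2 * pi * sigma ^+ 2)^-1 * expR (- (enorm (x - a) ^+ 2 / (2 * sigma ^+ 2))).

Definition truncation_mass (i : 'I_k) : R :=
  \int[lebesgue2]_(x in eball 0 M) gauss2 (m i) x.

Definition mixture_density (x : plane R) : R :=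
  \sum_(i < k) theta i / (2 * pi * sigma ^+ 2 * truncation_mass i)
    * expR (- (enorm (x - m i) ^+ 2 / (2 * sigma ^+ 2))) * \1_(eball 0 M) x.

Definition truncation_loss : R := 1 - inf (range truncation_mass).

Definition mean_separation : R :=
  inf [set b | exists i j, i != j /\ b = enorm (m i - m j)].

End quasi_gaussian_mixture.

(* Main.v *)
Require Import Defs.
From HB Require Import structures.
From mathcomp Require Import finmap.
From mathcomp Require Import all_boot all_order all_algebra.
From mathcomp Require Import all_classical all_reals all_analysis.
From mathcomp Require Import measurable_realfun ring lra.

Set Implicit Arguments.
Unset Strict Implicit.
Unset Printing Implicit Defensive.

Import Order.TTheory GRing.Theory Num.Theory.
Import numFieldNormedType.Exports.

Local Open Scope classical_set_scope.
Local Open Scope ring_scope.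

(** Write [beta] for a thirty-second of the separation [B] of the means, and
    [kap = beta ^+ 2 / (2 * sigma ^+ 2)].  Since the smallest weight is at most the
    largest one, the lower bound on their ratio forces [kap] to be at least the number
    of components, so that the means are many standard deviations apart.

    Every optimal codebook has a codepoint within [rho = 119 / 60 * beta] of each mean.
    The codebook made of the means has risk at most [2 * sigma ^+ 2 / N], where [N] is the
    least truncation mass: each truncated component has second moment at most
    [2 * sigma ^+ 2 / N] around its own mean (lemma [risk_means_le]).  A codebook without
    codepoint within [rho] of some mean pays at least [(rho - r) ^+ 2] on the disk of
    radius [r = 17 / 24 * beta] around that mean (lemma [risk_ge]), and by the first half
    of the assumption this is more (lemma [missed_mean_gt]).  Disks around distinct means
    being disjoint, means and codepoints are then matched by a permutation.

    From the matching, plane geometry gives the three quantities of the margin condition: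
    codepoints are [28 * beta] apart, the cell matched with a mean contains the disk of
    radius [8 * beta] around it, and the thickened frontier stays at distance
    [241 / 30 * beta] from all the means.  On the latter set the density is exponentially
    small, while the frontier is covered by one bisector per pair of codepoints, whose
    thickenings meet the truncation disk in an area at most [6 * M * t] each (lemma
    [strip_area]).  As there are quadratically many pairs, one factor [k] is not covered by
    the second half of the assumption.  It is paid for by taking [rho] smaller than
    [2 * beta]: the distance [241 / 30 * beta] exceeds [8 * beta], and the gain
    [expR (- kap / 2)] absorbs [k <= kap] (lemma [frontier_bound_le_margin]).

    All Gaussian masses and moments of disks reduce to one variable: the squared distance
    to a point maps planar Lebesgue measure to [pi] times Lebesgue measure on the half
    line (lemma [pushforward_sqdist]), because a disk of radius [r] has area
    [pi * r ^+ 2]. *)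

(** * Euclidean plane *)

Section euclidean_plane.
Context {R : realType}.
Implicit Types (x y z a : plane R) (r t : R).

Lemma enorm_ge0 x : 0 <= enorm x.
Proof. exact: sqrtr_ge0. Qed.

Lemma enorm_sqr x : enorm x ^+ 2 = x.1 ^+ 2 + x.2 ^+ 2.
Proof. by rewrite sqr_sqrtr// addr_ge0// sqr_ge0. Qed.

Lemma enorm_le x r : 0 <= r -> (enorm x <= r) = (x.1 ^+ 2 + x.2 ^+ 2 <= r ^+ 2).
Proof.
by move=> r0; rewrite -enorm_sqr -[RHS]ler_sqrt ?sqr_ge0// !sqrtr_sqr !ger0_norm// enorm_ge0.
Qed.

Lemma enorm0 : enorm (0 : plane R) = 0.
Proof. by rewrite /enorm /= expr0n /= addr0 sqrtr0. Qed.

Lemma enorm_eq0 x : enorm x = 0 -> x = 0.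
Proof.
move=> x0; have := enorm_sqr x; rewrite x0 expr0n /= => /esym/eqP.
rewrite paddr_eq0 ?sqr_ge0// !sqrf_eq0; case: x {x0} => x1 x2 /=.
by case/andP => /eqP -> /eqP ->.
Qed.

Lemma enormN x : enorm (- x) = enorm x.
Proof. by rewrite /enorm /= !sqrrN. Qed.

Lemma enormC x y : enorm (x - y) = enorm (y - x).
Proof. by rewrite -enormN opprB. Qed.

Lemma enorm_CS a x : `|a.1 * x.1 + a.2 * x.2| <= enorm a * enorm x.
Proof.
rewrite -(ler_pXn2r (n := 2)) ?nnegrE ?mulr_ge0 ?enorm_ge0//.
rewrite real_normK ?num_real// exprMn !enorm_sqr.
have := sqr_ge0 (a.1 * x.2 - a.2 * x.1); rewrite -subr_ge0 => h.
rewrite -subr_ge0; apply: le_trans h _; rewrite le_eqVlt; apply/orP; left.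
by apply/eqP; ring.
Qed.

Lemma enormD x y : enorm (x + y) <= enorm x + enorm y.
Proof.
rewrite enorm_le ?addr_ge0 ?enorm_ge0//=.
have := le_trans (ler_norm _) (enorm_CS x y).
have := enorm_sqr x; have := enorm_sqr y.
by nra.
Qed.

Lemma enorm_triangle z x y : enorm (x - y) <= enorm (x - z) + enorm (z - y).
Proof. by rewrite -[x - y](subrKA z) enormD. Qed.

Lemma measurable_enormB a : measurable_fun setT (fun x => enorm (x - a)).
Proof.
apply: (@measurableT_comp _ _ _ _ _ _ (@Num.sqrt R)).
  by apply: continuous_measurable_fun; exact: sqrt_continuous.
by apply: measurable_funD; apply: measurable_funX; apply: measurable_funB.
Qed.

Lemma measurable_eball a r : measurable (eball a r).
Proof.
rewrite -[X in measurable X]setTI.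
rewrite (_ : eball a r = (fun x => enorm (x - a)) @^-1` `]-oo, r]).
  exact: measurable_enormB.
by apply/seteqP; split => x; rewrite /eball /= in_itv.
Qed.

Lemma subset_eball x y r s : enorm (x - y) <= s - r -> eball x r `<=` eball y s.
Proof.
move=> xy z; rewrite /eball /= => zx; have := enorm_triangle x z y; lra.
Qed.

(** Open rational boxes form a countable base. *)
Lemma open_measurable_plane (U : set (plane R)) : open U -> measurable U.
Proof.
move=> oU.
pose box (q : rat * rat * rat * rat) : set (plane R) :=
  (`](ratr q.1.1.1), (ratr q.1.1.2)[%classic : set (measurableTypeR R)) `*`
  (`](ratr q.1.2), (ratr q.2)[%classic : set (measurableTypeR R)).
rewrite (_ : U = \bigcup_(q in [set q | box q `<=` U]) box q); last first.
  apply/seteqP; split; last by move=> x [q /= qU /qU].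
  move=> x Ux.
  have [/= [A B] [Ax Bx] ABU] : nbhs x U by exact: open_nbhs_nbhs.
  have [e1 /= e10 eA] := (nbhs_ballP _ _).1 Ax.
  have [e2 /= e20 eB] := (nbhs_ballP _ _).1 Bx.
  have rb (y e : R) : 0 < e -> exists p q : rat,
     [/\ ratr p < y, y < ratr q & forall z : R, ratr p < z < ratr q -> `|y - z| < e].
    move=> e0.
    have [p] : exists p : rat, ratr p \in `]y - e, y[ by apply: rat_in_itvoo; lra.
    have [q] : exists p : rat, ratr p \in `]y, y + e[ by apply: rat_in_itvoo; lra.
    rewrite !in_itv /= => /andP[q1 q2] /andP[p1 p2]; exists p, q; split => //.
    by move=> z /andP[z1 z2]; rewrite ltr_norml; lra.
  have [p1 [q1 [h1 h2 h3]]] := rb x.1 e1 e10.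
  have [p2 [q2 [k1 k2 k3]]] := rb x.2 e2 e20.
  exists (p1, q1, p2, q2) => /=.
    move=> y /= [y1 y2]; apply: ABU; split.
      by apply: eA; apply: h3; move: y1 => /=; rewrite in_itv.
    by apply: eB; apply: k3; move: y2 => /=; rewrite in_itv.
  by split; rewrite /= in_itv /=; apply/andP.
rewrite bigcup_mkcond; apply: countable_bigcupT_measurable => //.
move=> q; case: ifPn => // _; apply: measurableX; exact: measurable_itv.
Qed.

Lemma closed_measurable_plane (U : set (plane R)) : closed U -> measurable U.
Proof.
by move/closed_openC/open_measurable_plane/measurableC; rewrite setCK.
Qed.

Lemma continuous_enormB a : continuous (fun x => enorm (x - a)).
Proof.
move=> x; apply: (@continuous_comp _ _ _
  (fun y : plane R => (y - a).1 ^+ 2 + (y - a).2 ^+ 2 : R) (@Num.sqrt R)); last first.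
  exact: sqrt_continuous.
have c1 : {for x, continuous (fun y : plane R => (y - a).1)}.
  by apply: cvgB; [exact: cvg_fst|exact: cvg_cst].
have c2 : {for x, continuous (fun y : plane R => (y - a).2)}.
  by apply: cvgB; [exact: cvg_snd|exact: cvg_cst].
by apply: cvgD; apply: cvgM.
Qed.

Lemma closed_eball a r : closed (eball a r).
Proof.
rewrite (_ : eball a r = (fun x => enorm (x - a)) @^-1` [set y | y <= r])//.
by apply: preimage_closed; [move=> x _; exact: continuous_enormB|exact: closed_le].
Qed.

Lemma enorm_ge_coord x : `|x.1| <= enorm x /\ `|x.2| <= enorm x.
Proof.
have h : `|x.1| ^+ 2 <= enorm x ^+ 2 /\ `|x.2| ^+ 2 <= enorm x ^+ 2.
  by rewrite enorm_sqr !real_normK ?num_real// lerDl lerDr !sqr_ge0.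
by move: h; rewrite !ler_pXn2r// ?nnegrE ?enorm_ge0// ?normr_ge0.
Qed.

Lemma compact_eball r : compact (eball (0 : plane R) r).
Proof.
apply: (@subclosed_compact _ _ (`[- r, r]%classic `*` `[- r, r]%classic)).
- exact: closed_eball.
- by apply: compact_setX; exact: segment_compact.
move=> x; rewrite /eball /= subr0 => xr; have [h1 h2] := enorm_ge_coord x.
by rewrite /= !in_itv /= -!ler_norml (le_trans h1) ?(le_trans h2).
Qed.

(** The thickening is the union over [n] of the sums of the compact sets
    [A `&` eball 0 n%:R] and [eball 0 t], hence a countable union of compact sets. *)
Lemma measurable_ethickening (A : set (plane R)) t :
  closed A -> measurable (ethickening A t).
Proof.
move=> cA.
rewrite (_ : ethickening A t = \bigcup_n
   ((fun z : plane R * plane R => z.1 + z.2) @`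
     ((A `&` eball 0 n%:R) `*` eball 0 t))); last first.
  apply/seteqP; split => y.
    move=> [a Aa]; rewrite /eball /= => yat.
    exists `|Num.ceil (enorm a)|%N => //; exists (a, y - a) => /=; last by rewrite addrC subrK.
    rewrite /eball /= !subr0; split => //; split => //.
    have /andP[_ h] := real_ceil_itv (num_real (enorm a)).
    apply: le_trans h _.
    by rewrite natr_absz ler_int ler_norm.
  move=> [n _ [[a z] /= [[Aa _] +] <-]]; rewrite /eball /= subr0 => zt.
  by exists a => //; rewrite /eball /= addrAC subrr add0r.
apply: bigcupT_measurable => n; apply: closed_measurable_plane.
apply: compact_closed; first exact: norm_hausdorff.
apply: continuous_compact.
  apply: continuous_subspaceT => z; exact: add_continuous.
apply: compact_setX; last exact: compact_eball.
rewrite setIC; apply: compact_closedI => //; exact: compact_eball.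
Qed.

End euclidean_plane.

(** * Area of a disk *)

Section disk_area.
Context {R : realType}.
Local Notation mu := (@lebesgue_measure R).
Implicit Types (a x : plane R) (r v : R).

Let sqr_le_itv (x y : R) : 0 <= y -> (x ^+ 2 <= y ^+ 2) = (- y <= x <= y).
Proof.
by move=> y0; rewrite -ler_norml -[x ^+ 2]real_normK ?num_real// ler_pXn2r ?nnegrE.
Qed.

Let integral_cos_sqr r :
  (\int[mu]_(t in `[(- (pi / 2))%R, (pi / 2)%R]) (2 * r ^+ 2 * cos t ^+ 2)%:E = (pi * r ^+ 2)%:E)%E.
Proof.
have pi20 := @pi_gt0 R.
have dH (t : R) : is_derive t (1 : R) (fun t => r ^+ 2 * (t + sin t * cos t))
    (2 * r ^+ 2 * cos t ^+ 2).
  apply: is_derive_eq.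
  rewrite /GRing.scale /=; have := cos2Dsin2 t; nra.
have cf : continuous (fun t : R => 2 * r ^+ 2 * cos t ^+ 2).
  move=> t; apply: cvgM; first exact: cvg_cst.
  by apply: cvgM; exact: continuous_cos.
have cH : continuous (fun t : R => r ^+ 2 * (t + sin t * cos t)).
  move=> t; apply/differentiable_continuous/derivable1_diffP.
  by have [] := dH t.
rewrite (@continuous_FTC2 _ _ (fun t => r ^+ 2 * (t + sin t * cos t))).
- rewrite cosN sinN cos_pihalf !mulr0 !addr0 -EFinB; congr EFin; lra.
- by lra.
- by apply: continuous_subspaceT => t; exact: cf.
- split.
  + by move=> t _; have [] := dH t.
  + exact/cvg_at_right_filter/cH.
  + exact/cvg_at_left_filter/cH.
- by move=> t _; rewrite derive1E; have [] := dH t.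
Qed.

Let integral_semicircle (c r : R) : 0 < r ->
  (\int[mu]_(x in `[(c - r)%R, (c + r)%R]) (2 * Num.sqrt (r ^+ 2 - (x - c) ^+ 2))%:E
   = (pi * r ^+ 2)%:E)%E.
Proof.
move=> r0; have pi20 := @pi_gt0 R.
pose F (t : R) := c + r * sin t.
have dF (t : R) : is_derive t (1 : R) F (r * cos t).
  by apply: is_derive_eq; rewrite /GRing.scale /=; ring.
have F' : derive1 F = (fun t => r * cos t).
  by apply/funext => t; rewrite derive1E; have [] := dF t.
have cF : continuous F.
  by move=> t; apply/differentiable_continuous/derivable1_diffP; have [] := dF t.
have cF' : continuous (fun t => r * cos t).
  by move=> t; apply: cvgM; [exact: cvg_cst|exact: continuous_cos].
have -> : c - r = F (- (pi / 2)) by rewrite /F sinN sin_pihalf; ring.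
have -> : c + r = F (pi / 2) by rewrite /F sin_pihalf mulr1.
rewrite integration_by_substitution_increasing.
- rewrite F' -integral_cos_sqr; apply: eq_integral => t /=; rewrite inE /= in_itv /= => tp.
  congr EFin; rewrite !fctE /= /F.
  have c0 : 0 <= cos t by exact: cos_ge0_pihalf.
  rewrite (_ : r ^+ 2 - _ = (r * cos t) ^+ 2); last by have := cos2Dsin2 t; nra.
  by rewrite sqrtr_sqr ger0_norm ?mulr_ge0 ?(ltW r0)//; ring.
- by lra.
- by move=> s t sI tI st; rewrite /F ltrD2l ltr_pM2l// ltr_sin.
- by rewrite F' => t _; exact: cF'.
- by rewrite F'; apply: cvgP; exact/cvg_at_right_filter/cF'.
- by rewrite F'; apply: cvgP; exact/cvg_at_left_filter/cF'.
- split.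
  + by move=> t _; have [] := dF t.
  + exact/cvg_at_right_filter/cF.
  + exact/cvg_at_left_filter/cF.
- apply: continuous_subspaceT => x; apply: cvgM; first exact: cvg_cst.
  apply: (@continuous_comp _ _ _ (fun x : R => r ^+ 2 - (x - c) ^+ 2) (@Num.sqrt R));
    last exact: sqrt_continuous.
  apply: cvgB; first exact: cvg_cst.
  by apply: cvgM; apply: cvgB; [exact: cvg_id|exact: cvg_cst|exact: cvg_id|exact: cvg_cst].
Qed.

Lemma xsection_eball a r (u : R) :
  xsection [set x | enorm (x - a) ^+ 2 <= r ^+ 2] u =
  [set y | (y - a.2) ^+ 2 <= r ^+ 2 - (u - a.1) ^+ 2].
Proof.
apply/seteqP; split => y; rewrite /xsection /= inE /= enorm_sqr /=; lra.
Qed.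

(** One formula covers empty slices too, as [Num.sqrt] vanishes on negative numbers. *)
Lemma lebesgue_sqr_le (c w : R) :
  mu [set y | (y - c) ^+ 2 <= w] = (2 * Num.sqrt w)%:E.
Proof.
have [w0|w0] := leP 0 w; last first.
  rewrite (_ : [set y | _] = set0) ?measure0 ?ler0_sqrtr ?mulr0 ?(ltW w0)//.
  by apply/seteqP; split => // y /=; have := sqr_ge0 (y - c); lra.
rewrite (_ : [set y | _] = `[c - Num.sqrt w, c + Num.sqrt w]%classic).
  rewrite lebesgue_measure_itv /= lte_fin; have := sqrtr_ge0 w; case: ifPn => [_ _|].
    by rewrite -EFinB; congr EFin; ring.
  rewrite -leNgt => h h0; congr EFin; lra.
have E y : ((y - c) ^+ 2 <= w) = (- Num.sqrt w <= y - c <= Num.sqrt w).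
  by rewrite -[X in _ <= X](sqr_sqrtr w0) sqr_le_itv ?sqrtr_ge0.
by apply/seteqP; split => y /=; rewrite in_itv /= E; lra.
Qed.

(** The vertical slices of the disk have length [2 * Num.sqrt (r ^+ 2 - (u - a.1) ^+ 2)],
    which is integrated by substituting [u = a.1 + r * sin t]. *)
Lemma disk_area a r : 0 <= r -> lebesgue2 (eball a r) = (pi * r ^+ 2)%:E.
Proof.
rewrite le_eqVlt => r0.
have r0' : 0 <= r by rewrite le_eqVlt.
rewrite (_ : eball a r = [set x | enorm (x - a) ^+ 2 <= r ^+ 2]); last first.
  by apply/seteqP; split => x; rewrite /eball /= ler_pXn2r// ?nnegrE ?enorm_ge0.
rewrite /lebesgue2 /= /product_measure1 /=.
under eq_integral do rewrite xsection_eball lebesgue_sqr_le.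
have [/eqP r0e|rn0] := boolP (r == 0).
  rewrite r0e expr0n mulr0 integral0_eq// => x _.
  by rewrite ler0_sqrtr ?mulr0//= sub0r oppr_le0 sqr_ge0.
rewrite -(@integral_semicircle a.1); last by rewrite lt_neqAle eq_sym rn0.
rewrite [RHS]integral_mkcond; apply: eq_integral => x _.
rewrite patchE; case: ifPn => //; rewrite notin_setE /= in_itv /= => h.
rewrite ler0_sqrtr ?mulr0// subr_le0 leNgt; apply/negP => /ltW.
by rewrite sqr_le_itv// => ?; apply: h; lra.
Qed.

End disk_area.

(** * Radial integration *)

Section radial_integration.
Context {R : realType}.
Local Notation mu := (@lebesgue_measure R).
Variable a : plane R.

Definition sqdist (x : plane R) : measurableTypeR R := enorm (x - a) ^+ 2.

Lemma measurable_sqdist : measurable_fun setT sqdist.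
Proof. by apply: measurable_funX; exact: measurable_enormB. Qed.

Lemma sqdist_le_eball (v : R) : 0 <= v ->
  [set x | sqdist x <= v] = eball a (Num.sqrt v).
Proof.
move=> v0; have E x : (sqdist x <= v) = (enorm (x - a) <= Num.sqrt v).
  rewrite -[X in _ <= X](sqr_sqrtr v0).
  by rewrite ler_pXn2r// nnegrE ?enorm_ge0// sqrtr_ge0.
by apply/seteqP; split => x; rewrite /eball /= E.
Qed.

Let sublevel_area (v : R) :
  lebesgue2 [set x | sqdist x <= v] = (pi * Num.max v 0)%:E.
Proof.
have [v0|v0] := leP 0 v.
  by rewrite sqdist_le_eball// disk_area ?sqrtr_ge0// sqr_sqrtr.
rewrite (_ : [set x | _] = set0) ?measure0 ?mulr0//.
apply/seteqP; split => // x /=; rewrite leNgt => /negP; apply.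
by apply: lt_le_trans v0 _; exact: sqr_ge0.
Qed.

Let measurable_sublevel (v : R) : measurable [set x | sqdist x <= v].
Proof.
rewrite -[X in measurable X]setTI; rewrite (_ : [set x | _] = sqdist @^-1` `]-oo, v]%classic).
  exact: measurable_sqdist.
by apply/seteqP; split => x /=; rewrite in_itv.
Qed.

Let annulus_area (u w : R) : u <= w ->
  lebesgue2 (sqdist @^-1` `]u, w]%classic) = (pi * (Num.max w 0 - Num.max u 0))%:E.
Proof.
move=> uw.
have -> : sqdist @^-1` `]u, w]%classic = [set x | sqdist x <= w] `\` [set x | sqdist x <= u].
  apply/seteqP; split => x /=; rewrite in_itv /=.
    by move=> /andP[h1 h2]; split => //; apply/negP; rewrite -ltNge.
  by move=> [h1 /negP]; rewrite -ltNge => h2; apply/andP.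
rewrite measureD//=; last by rewrite sublevel_area ltry.
rewrite setIidr; last by move=> x /= /le_trans; apply.
by rewrite !sublevel_area -EFinB mulrBr.
Qed.

Let neg_part_length (u w : R) : u <= w ->
  mu (`]u, w]%classic `&` `]-oo, 0%R[%classic) = (Num.min w 0 - Num.min u 0)%:E.
Proof.
move=> uw; have [w0|w0] := ltP w 0.
  rewrite setIidl; last first.
    by move=> x /=; rewrite !in_itv /= => /andP[_ h]; exact: le_lt_trans h w0.
  rewrite lebesgue_measure_itv /= lte_fin (min_l (le_trans uw (ltW w0))).
  rewrite -EFinB; case: ltP => //; move: uw => /[swap] h1 h2.
  by congr EFin; apply/eqP; rewrite eq_sym subr_eq0 eq_le h1 h2.
have [u0|u0] := ltP u 0.
  rewrite (_ : _ `&` _ = `]u, 0%R[%classic).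
    by rewrite lebesgue_measure_itv /= lte_fin u0.
  apply/seteqP; split => x /=; rewrite !in_itv /=; first by move=> [/andP[-> _]].
  by move=> /andP[h1 h2]; split => //; rewrite h1 (le_trans (ltW h2)).
rewrite subrr (_ : _ `&` _ = set0) ?measure0//.
apply/seteqP; split => x //=; rewrite !in_itv /= => -[/andP[h1 _]].
by rewrite ltNge (le_trans u0 (ltW h1)).
Qed.

(** Annuli have area [pi] times the length of their range of squared radii;
    completing the image measure by Lebesgue measure on the negative reals turns
    this into an instance of the uniqueness of Lebesgue measure. *)
Lemma pushforward_sqdist (A : set (measurableTypeR R)) : measurable A ->
  A `<=` `[0%R, +oo[%classic ->
  (pushforward lebesgue2 sqdist A = pi%:E * mu A)%E.
Proof.
move=> mA A0.
have pi0 := @pi_gt0 R.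
have pi0' : 0 <= pi^-1 :> R by rewrite invr_ge0 ltW.
pose push := measure_function_pushforward__canonical__measure_function_Measure
  lebesgue2 measurable_sqdist.
pose neg : {measure set (measurableTypeR R) -> \bar R} :=
  mrestr mu (measurable_itv `]-oo, 0%R[).
pose nu := measure_add (mscale (NngNum pi0') push) neg.
have nuE : mu A = nu A.
  apply: (lebesgue_measure_unique (mu := nu)) => // _ [[u w] _ <-].
  rewrite [RHS](measure_addE (mscale (NngNum pi0') push) neg) /= /mscale /= /mrestr /pushforward.
  have [uw|uw] := leP u w; last first.
    rewrite set_itv_ge ?bnd_simp -?leNgt ?(ltW uw)//.
    by rewrite preimage_set0 set0I !measure0 mule0 adde0.
  rewrite neg_part_length// annulus_area// -EFinM -EFinD.
  rewrite lebesgue_measure_itv /= lte_fin mulKf ?gt_eqF//.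
  have -> : Num.max w 0 - Num.max u 0 + (Num.min w 0 - Num.min u 0) = w - u.
    by have [?|?] := leP w 0; have [?|?] := leP u 0; lra.
  case: ltP => // wu; congr EFin; apply/eqP; rewrite eq_sym subr_eq0 eq_le wu.
  by rewrite uw.
move: nuE; rewrite [nu A](measure_addE (mscale (NngNum pi0') push) neg) /= /mscale /= /mrestr /=.
rewrite (_ : A `&` _ = set0); last first.
  apply/seteqP; split => // x [/A0] /=; rewrite !in_itv /= andbT.
  by move=> h /(le_lt_trans h); rewrite ltxx.
rewrite measure0 adde0 => ->.
by rewrite muleA -EFinM divff ?gt_eqF// mul1e.
Qed.

(** Integration in polar coordinates, with the squared radius as variable. *)
Lemma integral_radial (h : R -> R) (r : R) :
  0 <= r -> measurable_fun setT h -> (forall v, 0 <= v -> 0 <= h v) ->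
  (\int[lebesgue2]_(x in eball a r) (h (enorm (x - a) ^+ 2))%:E
   = pi%:E * \int[mu]_(v in `[0%R, (r ^+ 2)%R]) (h v)%:E)%E.
Proof.
move=> r0 mh h0.
have -> : eball a r = sqdist @^-1` `[0, (r ^+ 2)%R]%classic.
  apply/seteqP; split => x; rewrite /eball /sqdist /= in_itv /= sqr_ge0 /=;
  by rewrite ler_pXn2r ?nnegrE ?enorm_ge0.
have mEh : measurable_fun `[0, (r ^+ 2)%R]%classic (fun v => (h v)%:E).
  by apply/measurable_EFinP; apply: measurable_funS mh.
transitivity (\int[pushforward lebesgue2 sqdist]_(v in `[0%R, (r ^+ 2)%R]) (h v)%:E)%E.
  rewrite ge0_integral_pushforward//; first exact: measurable_sqdist.
  by move=> v; rewrite inE /= in_itv /= => /andP[? _]; rewrite lee_fin h0.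
have pi0 : 0 <= pi :> R by exact: pi_ge0.
rewrite -(@ge0_integral_mscale _ _ _ mu _ (measurable_itv _) (NngNum pi0))//.
  apply: eq_measure_integral; first exact: measurable_sqdist.
  move=> ? A mA A0; apply: pushforward_sqdist => //.
  by move=> x /A0 /=; rewrite !in_itv /= => /andP[->].
by move=> v /=; rewrite in_itv /= => /andP[? _]; rewrite lee_fin h0.
Qed.

End radial_integration.

(** * Gaussian mass and second moment of a disk *)

Section gaussian_disk.
Context {R : realType}.
Local Notation mu := (@lebesgue_measure R).
Variables (sigma : R) (a : plane R).
Hypothesis sigma_gt0 : 0 < sigma.

Lemma gauss2_ge0 x : 0 <= gauss2 sigma a x.
Proof.
by rewrite mulr_ge0 ?expR_ge0// invr_ge0 mulr_ge0 ?sqr_ge0// mulr_ge0 ?pi_ge0.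
Qed.

Lemma measurable_gauss2 : measurable_fun setT (gauss2 sigma a).
Proof.
apply: measurable_funM; first exact: measurable_cst.
apply: measurableT_comp; first exact: measurable_expR.
apply: measurableT_comp; first exact: oppr_measurable.
by apply: measurable_funM => //; apply: measurable_funX; exact: measurable_enormB.
Qed.

Let w := 2 * sigma ^+ 2.
Let w_gt0 : 0 < w. Proof. by rewrite mulr_gt0// exprn_gt0. Qed.

Let density (v : R) := (2 * pi * sigma ^+ 2)^-1 * expR (- (v / w)).

Let density_ge0 v : 0 <= density v.
Proof.
by rewrite mulr_ge0 ?expR_ge0// invr_ge0 mulr_ge0 ?sqr_ge0// mulr_ge0 ?pi_ge0.
Qed.

Let is_derive_exp (v : R) : is_derive v (1 : R) (fun v : R => expR (- (v / w)))
  (- (w^-1 * expR (- (v / w)))).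
Proof.
have h : is_derive v (1 : R) (fun v : R => - (v / w)) (- w^-1).
  rewrite (_ : (fun v : R => - (v / w)) = - (fun v : R => w^-1 *: v)).
    by apply: is_derive_eq; rewrite /GRing.scale /= mulr1.
  by apply/funext => t; rewrite !fctE /GRing.scale /= mulrC.
have := is_derive1_comp (is_derive_expR _) h.
by move=> /is_derive_eq; apply; ring.
Qed.

Let continuous_exp : continuous (fun v : R => expR (- (v / w))).
Proof.
by move=> v; apply/differentiable_continuous/derivable1_diffP; have [] := is_derive_exp v.
Qed.

Let measurable_density : measurable_fun setT density.
Proof.
apply: measurable_funM; first exact: measurable_cst.
by apply: continuous_measurable_fun; exact: continuous_exp.
Qed.

Let FTC (F f : R -> R) (r : R) : 0 <= r -> continuous f ->
  (forall v, is_derive v (1 : R) F (f v)) ->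
  (\int[mu]_(v in `[0%R, r]) (f v)%:E = (F r - F 0)%:E)%E.
Proof.
rewrite le_eqVlt => /predU1P[<- _ _|r0 cf dF].
  by rewrite set_itv1 integral_set1 subrr.
have cF : continuous F.
  by move=> t; apply/differentiable_continuous/derivable1_diffP; have [] := dF t.
rewrite (@continuous_FTC2 _ _ F) ?EFinB//.
- by apply: continuous_subspaceT => t; exact: cf.
- split.
  + by move=> t _; have [] := dF t.
  + exact/cvg_at_right_filter/cF.
  + exact/cvg_at_left_filter/cF.
- by move=> t _; rewrite derive1E; have [] := dF t.
Qed.

Lemma gauss2_eball (r : R) : 0 <= r ->
  (\int[lebesgue2]_(x in eball a r) (gauss2 sigma a x)%:E
   = (1 - expR (- (r ^+ 2 / (2 * sigma ^+ 2))))%:E)%E.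
Proof.
move=> r0; rewrite (@integral_radial _ a density)//.
have dF (v : R) : is_derive v (1 : R) (fun v => - pi^-1 * expR (- (v / w))) (density v).
  have dE := is_derive_exp v; apply: is_derive_eq.
  rewrite /density /w /GRing.scale /=.
  by have := @pi_gt0 R; move: (@pi R) => p p0; field; rewrite !gt_eqF.
rewrite (FTC _ _ dF) ?sqr_ge0//.
  rewrite mul0r oppr0 expR0 -EFinM; congr EFin; rewrite -/w.
  by have := @pi_gt0 R; move: (@pi R) => p p0; field; rewrite gt_eqF.
by move=> v; apply: cvgM; [exact: cvg_cst|exact: continuous_exp].
Qed.

(** With the squared radius as variable this is the first moment, over a bounded interval,
    of the exponential distribution of mean [2 * sigma ^+ 2]. *)
Lemma gauss2_second_moment_le (r : R) : 0 <= r ->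
  (\int[lebesgue2]_(x in eball a r) (enorm (x - a) ^+ 2 * gauss2 sigma a x)%:E
   <= (2 * sigma ^+ 2)%:E)%E.
Proof.
move=> r0; rewrite (@integral_radial _ a (fun v => v * density v))//; first last.
- by move=> v v0; rewrite mulr_ge0.
- by apply: measurable_funM => //; exact: measurable_density.
have dF (v : R) : is_derive v (1 : R)
    (fun v => - pi^-1 * ((v + w) * expR (- (v / w)))) (v * density v).
  have dE := is_derive_exp v; apply: is_derive_eq.
  rewrite /density /w /GRing.scale /=.
  by have := @pi_gt0 R; move: (@pi R) => p p0; field; rewrite !gt_eqF.
rewrite (FTC _ _ dF) ?sqr_ge0//.
  rewrite mul0r oppr0 expR0 -EFinM lee_fin.
  rewrite (_ : pi * _ = w - (r ^+ 2 + w) * expR (- (r ^+ 2 / w))).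
    by rewrite gerBl mulr_ge0 ?expR_ge0// addr_ge0 ?sqr_ge0// ltW.
  by have := @pi_gt0 R; move: (@pi R) => p p0; field; rewrite gt_eqF.
move=> v; apply: cvgM; first exact: cvg_id.
by apply: cvgM; [exact: cvg_cst|exact: continuous_exp].
Qed.

End gaussian_disk.

(** * Area of a strip in a disk *)

Section strip_area.
Context {R : realType}.
Local Notation mu := (@lebesgue_measure R).
Implicit Types (a : plane R) (A : set (plane R)) (M L : R).

Let slice_integral_le (g : measurableTypeR R -> \bar R) M L : 0 <= M -> 0 <= L ->
  measurable_fun setT g -> (forall u, (0 <= g u <= L%:E)%E) ->
  (forall u, M < `|u| -> g u = 0%E) -> (\int[mu]_u g u <= (2 * M * L)%:E)%E.
Proof.
move=> M0 L0 mg gL gM.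
rewrite (_ : (\int[mu]_u g u = \int[mu]_(u in `[(- M)%R, M]) g u)%E); last first.
  rewrite [RHS]integral_mkcond; apply: eq_integral => u _.
  rewrite patchE; case: ifPn => //; rewrite notin_setE /= in_itv /= => h.
  by apply: gM; rewrite ltNge ler_norml; apply/negP.
apply: (@le_trans _ _ (\int[mu]_(u in `[(- M)%R, M]) (cst L%:E) u)%E).
  apply: ge0_le_integral => //.
  - by move=> u _; have /andP[] := gL u.
  - exact: measurable_funS mg.
  - by move=> u _; have /andP[] := gL u.
rewrite integral_cst//= lebesgue_measure_itv /= lte_fin.
case: ifPn => _; first by rewrite -EFinB -EFinM lee_fin; lra.
by rewrite mule0 lee_fin !mulr_ge0.
Qed.

Lemma lebesgue2_le_xslices A M L : measurable A -> 0 <= M -> 0 <= L ->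
  (forall x, A x -> `|x.1| <= M) ->
  (forall u, mu (xsection A u) <= L%:E)%E ->
  (lebesgue2 A <= (2 * M * L)%:E)%E.
Proof.
move=> mA M0 L0 AM AL; apply: slice_integral_le => //.
- exact: measurable_fun_xsection.
- by move=> u /=; rewrite measure_ge0 AL.
move=> u Mu /=; rewrite (_ : xsection A u = set0) ?measure0//.
apply/seteqP; split => // y; rewrite /xsection /= inE => /AM /=.
by rewrite leNgt Mu.
Qed.

Lemma lebesgue2_le_yslices A M L : measurable A -> 0 <= M -> 0 <= L ->
  (forall x, A x -> `|x.2| <= M) ->
  (forall u, mu (ysection A u) <= L%:E)%E ->
  (lebesgue2 A <= (2 * M * L)%:E)%E.
Proof.
move=> mA M0 L0 AM AL.
have -> : lebesgue2 A = (mu \x^ mu)%E A.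
  by apply: product_measure_unique => // B C mB mC; rewrite /= product_measure2E.
apply: slice_integral_le => //.
- exact: measurable_fun_ysection.
- by move=> u /=; rewrite measure_ge0 AL.
move=> u Mu /=; rewrite (_ : ysection A u = set0) ?measure0//.
apply/seteqP; split => // y; rewrite /ysection /= inE => /AM /=.
by rewrite leNgt Mu.
Qed.

Definition strip a (b t : R) : set (plane R) :=
  [set x | `|a.1 * x.1 + a.2 * x.2 - b| <= t * enorm a].

Lemma measurable_strip a b t : measurable (strip a b t).
Proof.
rewrite -[X in measurable X]setTI.
rewrite (_ : strip a b t = (fun x : plane R => `|a.1 * x.1 + a.2 * x.2 - b|) @^-1`
  `]-oo, (t * enorm a)%R]%classic).
  suff : measurable_fun setT (fun x : plane R => `|a.1 * x.1 + a.2 * x.2 - b|) by apply.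
  apply: measurableT_comp; first exact: normr_measurable.
  apply: measurable_funB => //; apply: measurable_funD; exact: measurable_funM.
by apply/seteqP; split => x; rewrite /strip /= in_itv.
Qed.

Let le_slice (X Y : set (measurableTypeR R)) L : measurable X -> measurable Y ->
  X `<=` Y -> (mu Y <= L%:E)%E -> (mu X <= L%:E)%E.
Proof. by move=> mX mY XY; apply: le_trans; apply: le_measure; rewrite ?inE. Qed.

Let affine_slice (p q b s t : R) : 0 <= t -> q != 0 -> t * s <= `|q| * (3 / 2 * t) ->
  (mu [set y | (`|p + q * y - b| <= t * s)%R] <= (3 * t)%:E)%E.
Proof.
move=> t0 q0 ts; have q0' : 0 < `|q| by rewrite normr_gt0.
have S : [set y | (`|p + q * y - b| <= t * s)%R] `<=`
    `[(b - p) / q - 3 / 2 * t, (b - p) / q + 3 / 2 * t]%classic.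
  move=> y /= h; rewrite in_itv /=.
  have : `|q| * `|y - (b - p) / q| <= `|q| * (3 / 2 * t).
    rewrite -normrM (_ : q * _ = p + q * y - b); last by field.
    exact: le_trans h ts.
  by rewrite ler_pM2l// ler_norml; lra.
apply: (le_slice _ _ S).
- rewrite -[X in measurable X]setTI.
  rewrite (_ : [set y | _] = (fun y => `|p + q * y - b|) @^-1` `]-oo, (t * s)%R]%classic).
    suff : measurable_fun setT (fun y : R => `|p + q * y - b|) by apply.
    apply: measurableT_comp; first exact: normr_measurable.
    by apply: measurable_funB => //; apply: measurable_funD => //; exact: measurable_funM.
  by apply/seteqP; split => x /=; rewrite in_itv.
- exact: measurable_itv.
rewrite lebesgue_measure_itv /= lte_fin; case: ifPn => _.
  by rewrite -EFinB lee_fin; lra.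
by rewrite lee_fin mulr_ge0.
Qed.

(** Slicing along the axis on which the normal vector has its larger coordinate,
    of absolute value at least [enorm a / sqrt 2 >= 2 / 3 * enorm a]. *)
Lemma strip_area a b t M : 0 < enorm a -> 0 <= t -> 0 <= M ->
  (lebesgue2 (strip a b t `&` eball 0%R M) <= (6 * M * t)%:E)%E.
Proof.
move=> a0 t0 M0.
have mS : measurable (strip a b t `&` eball 0%R M).
  by apply: measurableI; [exact: measurable_strip|exact: measurable_eball].
have -> : 6 * M * t = 2 * M * (3 * t) by ring.
have t30 : 0 <= 3 * t by rewrite mulr_ge0.
have a32 (p : R) : enorm a ^+ 2 <= 2 * p ^+ 2 -> t * enorm a <= `|p| * (3 / 2 * t).
  move=> h; rewrite mulrC -subr_ge0 mulrA -mulrBl mulr_ge0// subr_ge0.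
  have p0 : 0 <= `|p| * (3 / 2) by rewrite mulr_ge0.
  rewrite -(ler_pXn2r (n := 2))// ?nnegrE ?enorm_ge0//.
  by rewrite exprMn real_normK ?num_real//; have := sqr_ge0 p; lra.
have p0 (p : R) : enorm a ^+ 2 <= 2 * p ^+ 2 -> p != 0.
  move=> h; apply/eqP => pe; move: h; rewrite pe expr0n mulr0 /=.
  by rewrite leNgt exprn_gt0.
have [h|h] := leP (a.1 ^+ 2) (a.2 ^+ 2).
  have ha : enorm a ^+ 2 <= 2 * a.2 ^+ 2 by rewrite enorm_sqr; lra.
  apply: lebesgue2_le_xslices => //.
    move=> x [_]; rewrite /eball /= subr0 => /(le_trans _); apply.
    exact: (enorm_ge_coord x).1.
  move=> u; apply: le_slice (affine_slice (a.1 * u) b t0 (p0 _ ha) (a32 _ ha)).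
  - exact: measurable_xsection.
  - have := @measurable_xsection _ _ _ _ _ u (measurable_strip a b t).
    by congr measurable; apply/seteqP; split => y; rewrite /xsection /strip /= inE.
  - by move=> y; rewrite /xsection /= inE => -[].
have ha : enorm a ^+ 2 <= 2 * a.1 ^+ 2 by rewrite enorm_sqr; lra.
apply: lebesgue2_le_yslices => //.
  move=> x [_]; rewrite /eball /= subr0 => /(le_trans _); apply.
  exact: (enorm_ge_coord x).2.
move=> u; apply: le_slice (affine_slice (a.2 * u) b t0 (p0 _ ha) (a32 _ ha)).
- exact: measurable_ysection.
- have := @measurable_ysection _ _ _ _ _ u (measurable_strip a b t).
  by congr measurable; apply/seteqP; split => y; rewrite /ysection /strip /= inE /= (addrC (a.2 * u)).
- by move=> y; rewrite /ysection /= inE => -[]; rewrite /strip /= (addrC (a.2 * u)).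
Qed.

End strip_area.

(** * Integration against the mixture *)

(** The density [f] agrees almost everywhere with the Radon-Nikodym derivative of [P]. *)
Lemma integral_density (d : measure_display) (T : measurableType d) (R : realType)
    (mu : {sigma_finite_measure set T -> \bar R}) (P : probability T R)
    (f : T -> R) (g : T -> \bar R) :
  measurable_fun setT f -> (forall x, 0 <= f x) ->
  (forall A, measurable A -> P A = (\int[mu]_(x in A) (f x)%:E)%E) ->
  measurable_fun setT g -> (forall x, 0 <= g x)%E ->
  (\int[P]_x g x = \int[mu]_x (g x * (f x)%:E))%E.
Proof.
move=> mf f0 Pf mg g0.
have mEf : measurable_fun setT (EFin \o f) by exact/measurable_EFinP.
have Pmu : P `<< mu.
  apply/null_content_dominatesP => A mA muA0; rewrite Pf//.
  by apply: null_set_integral => //; exact: measurable_funTS.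
pose h := Radon_Nikodym_SigmaFinite.f P mu.
have mh : measurable_fun setT h.
  exact: measurable_int (Radon_Nikodym_SigmaFinite.f_integrable Pmu).
have fh : ae_eq mu setT h (EFin \o f).
  apply: integral_ae_eq => //; first exact: Radon_Nikodym_SigmaFinite.f_integrable.
  move=> A _ mA; rewrite -Radon_Nikodym_SigmaFinite.f_integral//.
  by rewrite -[RHS]Pf.
rewrite -(Radon_Nikodym_SigmaFinite.change_of_variables Pmu)//.
apply: ae_eq_integral => //.
- exact: emeasurable_funM.
- exact: emeasurable_funM.
- exact: ae_eqe_mul2l.
Qed.

Lemma sigma_finite_lebesgue2 (R : realType) : sigma_finite setT (@lebesgue2 R).
Proof.
exists (fun n => eball 0 n%:R).
  apply/esym/seteqP; split => // x _.
  exists `|Num.ceil (enorm x)|%N => //; rewrite /eball /= subr0.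
  apply: le_trans (Num.Theory.ceil_ge _) _.
  by rewrite natr_absz ler_int ler_norm.
move=> n; split; first exact: measurable_eball.
by rewrite disk_area ?ltry.
Qed.

(** A copy of [lebesgue2] that carries a sigma-finite structure, as Radon-Nikodym requires. *)
Definition lebesgue_plane (R : realType) : set (plane R) -> \bar R := lebesgue2.
HB.instance Definition _ (R : realType) := Measure.on (@lebesgue_plane R).
HB.instance Definition _ (R : realType) :=
  @Measure_isSigmaFinite.Build _ _ R (@lebesgue_plane R) (@sigma_finite_lebesgue2 R).

Section mixture.
Context {R : realType} {k : nat}.
Variables (M sigma : R) (m : 'I_k -> plane R) (theta : 'I_k -> R).
Hypothesis theta_ge0 : forall i, 0 <= theta i.
Local Notation N := (truncation_mass M sigma m).

Lemma measurable_eball_indic : measurable_fun setT (\1_(eball (0 : plane R) M) : plane R -> R).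
Proof. by apply: measurable_indic; exact: measurable_eball. Qed.

Lemma mixture_densityE x : mixture_density M sigma m theta x =
  \sum_(i < k) theta i / N i * (gauss2 sigma (m i) x * \1_(eball 0 M) x).
Proof.
apply: eq_bigr => i _; rewrite /gauss2 (invfM (2 * pi * sigma ^+ 2)); ring.
Qed.

Lemma truncation_mass_ge0 i : 0 <= N i.
Proof. by apply: fine_ge0; apply: integral_ge0 => x _; rewrite lee_fin gauss2_ge0. Qed.

Lemma mixture_weight_ge0 i : 0 <= theta i / N i.
Proof. by rewrite divr_ge0 ?truncation_mass_ge0. Qed.

Lemma mixture_density_ge0 x : 0 <= mixture_density M sigma m theta x.
Proof.
rewrite mixture_densityE; apply: sumr_ge0 => i _.
by rewrite mulr_ge0 ?mixture_weight_ge0// mulr_ge0 ?gauss2_ge0// indicE.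
Qed.

Lemma measurable_mixture_density : measurable_fun setT (mixture_density M sigma m theta).
Proof.
rewrite (_ : mixture_density M sigma m theta = fun x => \sum_(i < k)
   theta i / N i * (gauss2 sigma (m i) x * \1_(eball 0 M) x)); last first.
  by apply/funext => x; exact: mixture_densityE.
apply: measurable_sum => i; apply: measurable_funM => //.
by apply: measurable_funM; [exact: measurable_gauss2|exact: measurable_eball_indic].
Qed.

Variable P : probability (plane R) R.
Hypothesis P_density : has_density P (mixture_density M sigma m theta).

Lemma integral_mixture (g : plane R -> R) :
  measurable_fun setT g -> (forall x, 0 <= g x) ->
  (\int[P]_x (g x)%:E = \sum_(i < k) (theta i / N i)%:E *
     \int[lebesgue2]_(x in eball 0%R M) (g x * gauss2 sigma (m i) x)%:E)%E.
Proof.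
move=> mg g0.
rewrite (@integral_density _ (plane R) R (@lebesgue_plane R)
  P (mixture_density M sigma m theta))//; last first.
- exact/measurable_EFinP.
- exact: mixture_density_ge0.
- exact: measurable_mixture_density.
have mG i : measurable_fun setT (fun x => (g x * gauss2 sigma (m i) x * \1_(eball 0 M) x)%:E).
  apply/measurable_EFinP; apply: measurable_funM; last exact: measurable_eball_indic.
  by apply: measurable_funM => //; exact: measurable_gauss2.
have G0 i x : (0 <= (g x * gauss2 sigma (m i) x * \1_(eball 0 M) x)%:E)%E.
  by rewrite lee_fin; apply: mulr_ge0 => //; apply: mulr_ge0 => //; exact: gauss2_ge0.
transitivity (\int[lebesgue2]_x \sum_(i < k) ((theta i / N i)%:E *
    (g x * gauss2 sigma (m i) x * \1_(eball 0%R M) x)%:E))%E.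
  apply: eq_integral => x _; rewrite mixture_densityE -EFinM mulr_sumr -sumEFin.
  by apply: eq_bigr => i _; rewrite -EFinM; congr EFin; ring.
rewrite ge0_integral_sum//; last 2 first.
- by move=> i; apply: emeasurable_funM.
- by move=> i x _; rewrite mule_ge0// lee_fin mixture_weight_ge0.
apply: eq_bigr => i _; rewrite ge0_integralZl//; last by rewrite lee_fin mixture_weight_ge0.
congr (_ * _)%E; rewrite [RHS]integral_mkcond; apply: eq_integral => x _.
by rewrite patchE indicE; case: ifPn => xb; rewrite ?mulr1 ?mulr0.
Qed.

Lemma mixture_mass (A : set (plane R)) : measurable A -> A `<=` eball 0 M ->
  P A = (\sum_(i < k) (theta i / N i)%:E *
     \int[lebesgue2]_(x in A) (gauss2 sigma (m i) x)%:E)%E.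
Proof.
move=> mA AM; rewrite -[A]setIT -integral_indic//.
rewrite integral_mixture//; apply: eq_bigr => i _; congr (_ * _)%E.
rewrite setIT [RHS]integral_mkcond [LHS]integral_mkcond; apply: eq_integral => x _.
rewrite !patchE indicE; have [xA|xA] := boolP (x \in A).
  by rewrite mem_set ?mul1r//; apply: AM; exact: set_mem.
by rewrite mul0r; case: ifP.
Qed.

Lemma mixture_outside (A : set (plane R)) : measurable A -> A `&` eball 0 M = set0 ->
  P A = 0%E.
Proof.
move=> mA AM; rewrite P_density//; apply: integral0_eq => x Ax.
rewrite mixture_densityE big1// => i _; rewrite indicE memNset ?mulr0//.
by move=> xM; have : (A `&` eball 0 M) x by []; rewrite AM.
Qed.

Lemma mixture_bounded : bounded_by P M.
Proof.
move=> x supp; apply: contrapT => xM.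
have oC : open (~` eball (0 : plane R) M) by apply: closed_openC; exact: closed_eball.
have P0 : P (~` eball 0 M) = 0%E.
  apply: mixture_outside; first exact: open_measurable_plane.
  by rewrite setICl.
by have := supp _ oC xM; rewrite [X in (_ < X)%E]P0 ltxx.
Qed.

End mixture.

(** * Voronoi cells and frontiers *)

Section finite_inf_sup.
Context {R : realType} {k : nat}.
Implicit Types F : 'I_k -> R.

Let abs_le_sum F i : `|F i| <= \sum_j `|F j|.
Proof. by rewrite (bigD1 i)//= lerDl sumr_ge0. Qed.

Lemma inf_range_le F i : inf (range F) <= F i.
Proof.
apply: ge_inf; last by exists i.
exists (- \sum_j `|F j|) => _ [j _ <-].
by have := abs_le_sum F j; rewrite ler_norml => /andP[].
Qed.

Lemma le_sup_range F i : F i <= sup (range F).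
Proof.
apply: ub_le_sup; last by exists i.
exists (\sum_j `|F j|) => _ [j _ <-].
by have := abs_le_sum F j; rewrite ler_norml => /andP[].
Qed.

Lemma le_inf_range F y : (0 < k)%N -> (forall i, y <= F i) -> y <= inf (range F).
Proof.
move=> k0 yF; apply: lb_le_inf; first by exists (F (Ordinal k0)), (Ordinal k0).
by move=> _ [i _ <-].
Qed.

Lemma inf_rangeE F i0 : inf (range F) = \big[Num.min/F i0]_(i < k) F i.
Proof.
apply/eqP; rewrite eq_le; apply/andP; split.
  by apply: le_bigmin => [|i _]; exact: inf_range_le.
apply: le_inf_range => [|i]; first by case: k i0 {F} => // -[].
exact: bigmin_le.
Qed.

End finite_inf_sup.

Section quantization_geometry.
Context {R : realType} {k : nat}.
Implicit Types c m : codebook R k.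

Definition nearest_sqdist c (x : plane R) : R :=
  inf (range (fun j => enorm (x - c j) ^+ 2)).

Lemma nearest_sqdist_ge0 c x : (0 < k)%N -> 0 <= nearest_sqdist c x.
Proof. by move=> k0; apply: le_inf_range => // i; exact: sqr_ge0. Qed.

Lemma measurable_nearest_sqdist c : (0 < k)%N -> measurable_fun setT (nearest_sqdist c).
Proof.
move=> k0; pose F i x := enorm (x - c i) ^+ 2.
have mF i : measurable_fun setT (F i).
  by apply: measurable_funX; exact: measurable_enormB.
rewrite (_ : nearest_sqdist c = fun x =>
  \big[Num.min/F (Ordinal k0) x]_(i <- index_enum 'I_k) F i x); last first.
  by apply/funext => x; rewrite /nearest_sqdist (inf_rangeE _ (Ordinal k0)).
elim: (index_enum _) => [|i s IHs].
  by apply: eq_measurable_fun (mF (Ordinal k0)) => x _; rewrite big_nil.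
by apply: eq_measurable_fun (measurable_minr (mF i) IHs) => x _; rewrite big_cons.
Qed.

Lemma closed_voronoi c i : closed (voronoi c i).
Proof.
rewrite (_ : voronoi c i = \bigcap_(j in [set j | j != i])
   (fun x => enorm (x - c i) - enorm (x - c j)) @^-1` [set y | y <= 0]).
  apply: closed_bigI => j _; apply: preimage_closed; last exact: closed_le.
  by move=> x _; apply: cvgB; exact: continuous_enormB.
by apply/seteqP; split => x /= h j /h; rewrite /= subr_le0.
Qed.

Lemma closed_frontier c : closed (frontier c).
Proof.
rewrite (_ : frontier c = \bigcup_(p in [set p : 'I_k * 'I_k | p.1 != p.2])
   (voronoi c p.1 `&` voronoi c p.2)).
  apply: closed_bigcup => [|p _]; first exact: finite_finset.
  by apply: closedI; exact: closed_voronoi.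
apply/seteqP; split => x; first by move=> [i [j [ij xij]]]; exists (i, j).
by move=> [[i j] /= ij xij]; exists i, j.
Qed.

(** A point of [frontier c] is equidistant from two codepoints, hence lies on their
    bisector; moving by [t] changes the defining linear form by at most [t] times the
    norm of the normal vector. *)
Lemma frontier_thickening_strip c t : 0 <= t ->
  ethickening (frontier c) t `<=` \bigcup_(p in [set p : 'I_k * 'I_k | p.1 != p.2])
     strip (c p.1 - c p.2) ((enorm (c p.1) ^+ 2 - enorm (c p.2) ^+ 2) / 2) t.
Proof.
move=> t0 y [x [i [j [ij [Vi Vj]]]] yx].
exists (i, j) => //=; rewrite /strip /=.
have xij : enorm (x - c i) ^+ 2 = enorm (x - c j) ^+ 2.
  by congr (_ ^+ 2); apply/eqP; rewrite eq_le Vi 1?eq_sym// Vj.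
set a := c i - c j.
have -> : ((c i).1 - (c j).1) * y.1 + ((c i).2 - (c j).2) * y.2
    - (enorm (c i) ^+ 2 - enorm (c j) ^+ 2) / 2 = a.1 * (y - x).1 + a.2 * (y - x).2.
  by move: xij; rewrite !enorm_sqr /= /a /=; lra.
by apply: le_trans (enorm_CS _ _) _; rewrite mulrC ler_wpM2r ?enorm_ge0.
Qed.

Section matched.
Variables (c m : codebook R k) (tau : 'I_k -> 'I_k) (B rho : R).
Hypothesis m_sep : forall i j, i != j -> B <= enorm (m i - m j).
Hypothesis c_near : forall i, enorm (c (tau i) - m i) <= rho.
Hypothesis tau_surj : forall j, exists i, j = tau i.

Lemma matched_sep j l : j != l -> B - 2 * rho <= enorm (c j - c l).
Proof.
have [i ->] := tau_surj j; have [h ->] := tau_surj l => jl.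
have ih : i != h by apply: contraNneq jl => ->.
have := m_sep ih; have := enorm_triangle (c (tau i)) (m i) (m h).
have := enorm_triangle (c (tau h)) (c (tau i)) (m h).
have := c_near i; have := c_near h; rewrite (enormC (m i) (c _)); lra.
Qed.

Lemma matched_voronoi i r : 2 * r + 2 * rho <= B ->
  eball (m i) r `<=` voronoi c (tau i).
Proof.
move=> rB x; rewrite /eball /= => xi j ji.
have [h jh] := tau_surj j.
have ih : i != h by apply: contraNneq ji => ih; rewrite jh ih.
have := m_sep ih; have := enorm_triangle x (m i) (m h).
have := enorm_triangle (c j) x (m h); have := enorm_triangle (m i) x (c (tau i)).
have := c_near i; have := c_near h; rewrite -jh (enormC (m i) (c _)) (enormC (m i) x); lra.
Qed.

(** A frontier point is equidistant from its two nearest codepoints, so at least half of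
    their separation away from every codepoint. *)
Lemma matched_frontier_far t y i : ethickening (frontier c) t y ->
  B / 2 - 2 * rho - t <= enorm (y - m i).
Proof.
move=> [x [j [l [jl [Vj Vl]]]]]; rewrite /eball /= => yx.
have xjl : enorm (x - c j) = enorm (x - c l).
  by apply/eqP; rewrite eq_le Vj 1?eq_sym// Vl.
have xi : enorm (x - c j) <= enorm (x - c (tau i)).
  by have [->//|ij] := eqVneq (tau i) j; exact: Vj.
have := matched_sep jl; have := enorm_triangle x (c j) (c l).
have := enorm_triangle (m i) x (c (tau i)); have := enorm_triangle y x (m i).
have := c_near i; rewrite (enormC (m i) (c _)) (enormC x y) (enormC (c j) x); lra.
Qed.

End matched.
End quantization_geometry.

(** * Mass and risk bounds for the mixture *)

Section mixture_bounds.
Context {R : realType} {k : nat}.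
Variables (M sigma : R) (m : 'I_k -> plane R) (theta : 'I_k -> R).
Hypothesis k_gt0 : (0 < k)%N.
Hypothesis M_ge0 : 0 <= M.
Hypothesis sigma_gt0 : 0 < sigma.
Hypothesis theta_ge0 : forall i, 0 <= theta i.
Hypothesis theta_sum : \sum_(i < k) theta i = 1.
Hypothesis m_in : forall i, eball 0 M (m i).
Local Notation N := (truncation_mass M sigma m).
Local Notation gauss i := (fun x => (gauss2 sigma (m i) x)%:E).

Let mgauss i (A : set (plane R)) : measurable_fun A (gauss i).
Proof. by apply/measurable_EFinP; apply: measurable_funTS; exact: measurable_gauss2. Qed.

Let disk_subset i : eball 0 M `<=` eball (m i) (2 * M).
Proof.
apply: subset_eball; rewrite sub0r enormN.
by have := m_in i; rewrite /eball /= subr0; lra.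
Qed.

Let gauss_mass_le1 i : (\int[lebesgue2]_(x in eball 0%R M) gauss i x <= 1)%E.
Proof.
apply: (@le_trans _ _ (\int[lebesgue2]_(x in eball (m i) (2 * M)%R) gauss i x)%E).
  apply: ge0_subset_integral; try exact: measurable_eball; last exact: disk_subset.
    exact: mgauss.
  by move=> x _; rewrite lee_fin gauss2_ge0.
by rewrite gauss2_eball ?mulr_ge0// lee_fin gerBl expR_ge0.
Qed.

Let gauss_mass_fin i : (\int[lebesgue2]_(x in eball 0%R M) gauss i x)%E \is a fin_num.
Proof.
rewrite ge0_fin_numE; first exact: le_lt_trans (gauss_mass_le1 i) (ltry _).
by apply: integral_ge0 => x _; rewrite lee_fin gauss2_ge0.
Qed.

Lemma truncation_mass_le1 i : N i <= 1.
Proof. by rewrite -lee_fin /truncation_mass /Rintegral fineK. Qed.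

Lemma truncation_mass_ge i r : 0 <= r -> eball (m i) r `<=` eball 0 M ->
  1 - expR (- (r ^+ 2 / (2 * sigma ^+ 2))) <= N i.
Proof.
move=> r0 rM; rewrite -lee_fin /truncation_mass /Rintegral fineK//.
rewrite -(gauss2_eball (m i))//; apply: ge0_subset_integral; try exact: measurable_eball.
- exact: mgauss.
- by move=> x _; rewrite lee_fin gauss2_ge0.
- exact: rM.
Qed.

Variable Nmin : R.
Hypothesis Nmin_gt0 : 0 < Nmin.
Hypothesis Nmin_le : forall i, Nmin <= N i.

Let N_gt0 i : 0 < N i. Proof. exact: lt_le_trans (Nmin_le i). Qed.

Let invN_le i : (N i)^-1 <= Nmin^-1.
Proof. by rewrite lef_pV2; [exact: Nmin_le|exact: N_gt0|exact: Nmin_gt0]. Qed.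

Variable P : probability (plane R) R.
Hypothesis P_density : has_density P (mixture_density M sigma m theta).

Lemma mixture_mass_eball_ge i r : 0 <= r -> eball (m i) r `<=` eball 0 M ->
  ((theta i * (1 - expR (- (r ^+ 2 / (2 * sigma ^+ 2)))))%:E <= P (eball (m i) r))%E.
Proof.
move=> r0 rM; have e1 : 0 <= 1 - expR (- (r ^+ 2 / (2 * sigma ^+ 2))).
  rewrite subr_ge0 -[X in _ <= X]expR0 ler_expR oppr_le0.
  by rewrite divr_ge0 ?sqr_ge0// mulr_ge0// sqr_ge0.
rewrite (mixture_mass theta_ge0 P_density)//; last exact: measurable_eball.
rewrite (bigD1 i)//= gauss2_eball// -EFinM.
apply: le_trans (leeDl _ _); last first.
  apply: sume_ge0 => j _; rewrite mule_ge0 ?lee_fin ?mixture_weight_ge0//.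
  by apply: integral_ge0 => x _; rewrite lee_fin gauss2_ge0.
rewrite lee_fin ler_wpM2r// ler_pdivlMr//.
by rewrite ler_piMr// truncation_mass_le1.
Qed.

(** The nearest mean is no farther than the mean of the component, and the truncation
    only decreases the unnormalized second moment of a component. *)
Lemma risk_means_le : (risk P m <= (2 * sigma ^+ 2 / Nmin)%:E)%E.
Proof.
rewrite /risk (integral_mixture theta_ge0 P_density
  (measurable_nearest_sqdist m k_gt0))//; last by move=> x; exact: nearest_sqdist_ge0.
apply: (@le_trans _ _ (\sum_(i < k) (theta i / Nmin * (2 * sigma ^+ 2))%:E)%E).
  apply: lee_sum => i _; rewrite [in leRHS]EFinM; apply: lee_pmul.
  - by rewrite lee_fin mixture_weight_ge0.
  - apply: integral_ge0 => x _; rewrite lee_fin; apply: mulr_ge0; last exact: gauss2_ge0.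
    exact: nearest_sqdist_ge0.
  - by rewrite lee_fin; apply: ler_wpM2l.
  apply: le_trans (gauss2_second_moment_le (m i) sigma_gt0 (r := 2 * M) _);
    last by rewrite mulr_ge0.
  have mh (h : plane R -> R) (A : set (plane R)) : measurable_fun setT h ->
      measurable_fun A (fun x => (h x * gauss2 sigma (m i) x)%:E).
    move=> mh; apply/measurable_EFinP; apply: measurable_funTS.
    by apply: measurable_funM => //; exact: measurable_gauss2.
  have md : measurable_fun setT (fun x : plane R => enorm (x - m i) ^+ 2).
    by apply: measurable_funX; exact: measurable_enormB.
  apply: (@le_trans _ _ (\int[lebesgue2]_(x in eball 0%R M)
      (enorm (x - m i) ^+ 2 * gauss2 sigma (m i) x)%:E)%E).
    apply: ge0_le_integral; first exact: measurable_eball.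
    - move=> x _; rewrite lee_fin; apply: mulr_ge0; last exact: gauss2_ge0.
      exact: nearest_sqdist_ge0.
    - by apply: mh; exact: measurable_nearest_sqdist.
    - exact: mh.
    - by move=> x _; rewrite lee_fin ler_wpM2r ?gauss2_ge0// inf_range_le.
  apply: ge0_subset_integral; try exact: measurable_eball; last exact: disk_subset.
    exact: mh.
  by move=> x _; rewrite lee_fin; apply: mulr_ge0; [exact: sqr_ge0|exact: gauss2_ge0].
rewrite sumEFin -mulr_suml -mulr_suml theta_sum lee_fin.
by rewrite mul1r mulrC.
Qed.

(** On the disk of radius [r] around the mean, all codepoints are at distance at least
    [rho - r]. *)
Lemma risk_ge (c : codebook R k) i (rho r : R) : 0 <= r <= rho ->
  (forall j, rho <= enorm (c j - m i)) -> eball (m i) r `<=` eball 0 M ->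
  (((rho - r) ^+ 2 * (theta i * (1 - expR (- (r ^+ 2 / (2 * sigma ^+ 2))))))%:E <= risk P c)%E.
Proof.
move=> /andP[r0 rrho] far rM.
have mS (A : set (plane R)) : measurable_fun A (fun x => (nearest_sqdist c x)%:E).
  by apply/measurable_EFinP; apply: measurable_funTS; exact: measurable_nearest_sqdist.
apply: (@le_trans _ _ (\int[P]_(x in eball (m i) r) (nearest_sqdist c x)%:E)%E); last first.
  apply: ge0_subset_integral; [exact: measurable_eball|exact: measurableT|exact: mS| |by []].
  by move=> x _; rewrite lee_fin; exact: nearest_sqdist_ge0.
apply: (@le_trans _ _ (\int[P]_(x in eball (m i) r) (cst ((rho - r) ^+ 2)%:E) x)%E); last first.
  apply: ge0_le_integral; first exact: measurable_eball.
  - by move=> x _; rewrite lee_fin sqr_ge0.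
  - exact: measurable_cst.
  - exact: mS.
  - move=> x; rewrite /eball /= => xi; rewrite lee_fin; apply: le_inf_range => // j.
    rewrite ler_pXn2r// ?nnegrE ?subr_ge0 ?enorm_ge0//.
    have := far j; have := enorm_triangle x (c j) (m i); rewrite (enormC (c j) x); lra.
rewrite integral_cst; last exact: measurable_eball.
by rewrite EFinM lee_wpmul2l ?lee_fin ?sqr_ge0//; exact: mixture_mass_eball_ge.
Qed.

(** The height at distance [d] of an untruncated Gaussian, normalized by the least
    truncation mass. *)
Definition far_density_bound (d : R) : R :=
  Nmin^-1 * ((2 * pi * sigma ^+ 2)^-1 * expR (- (d ^+ 2 / (2 * sigma ^+ 2)))).

Lemma mixture_density_le d x : 0 <= d -> (forall i, d <= enorm (x - m i)) ->
  mixture_density M sigma m theta x <=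
  far_density_bound d * \1_(eball 0 M) x.
Proof.
move=> d0 xd; rewrite mixture_densityE.
rewrite (_ : _ * _ = \sum_(i < k) theta i *
    (Nmin^-1 * ((2 * pi * sigma ^+ 2)^-1 * expR (- (d ^+ 2 / (2 * sigma ^+ 2)))
      * \1_(eball 0 M) x))); last first.
  by rewrite -mulr_suml theta_sum /far_density_bound; ring.
apply: ler_sum => i _; rewrite -[leLHS]mulrA; apply: ler_wpM2l => //.
apply: ler_pM; [by rewrite invr_ge0 ltW| |exact: invN_le|].
  by apply: mulr_ge0 => //; exact: gauss2_ge0.
apply: ler_wpM2r => //; rewrite /gauss2 ler_wpM2l//.
  by rewrite invr_ge0 mulr_ge0 ?sqr_ge0// mulr_ge0 ?pi_ge0.
rewrite ler_expR lerN2 ler_pM2r ?invr_gt0 ?mulr_gt0 ?exprn_gt0//.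
by rewrite ler_pXn2r// nnegrE ?enorm_ge0.
Qed.

(** The thickened frontier is covered by one strip for each ordered pair of codepoints. *)
Lemma frontier_thickening_area (c : codebook R k) t : 0 <= t -> injective c ->
  (lebesgue2 (ethickening (frontier c) t `&` eball 0%R M) <= (k%:R ^+ 2 * (6 * M * t))%:E)%E.
Proof.
move=> t0 cinj.
pose S (p : 'I_k * 'I_k) := strip (c p.1 - c p.2)
  ((enorm (c p.1) ^+ 2 - enorm (c p.2) ^+ 2) / 2) t `&` eball 0 M.
pose D := [set p : 'I_k * 'I_k | p.1 != p.2].
have mS p : measurable (S p).
  by apply: measurableI; [exact: measurable_strip|exact: measurable_eball].
apply: (@le_trans _ _ (\sum_(p \in D) lebesgue2 (S p))%E).
  apply: content_sub_fsum; first exact: finite_finset.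
  - by move=> p _; exact: mS.
  - apply: measurableI; last exact: measurable_eball.
    by apply: measurable_ethickening; exact: closed_frontier.
  - move=> x [/(frontier_thickening_strip t0)[p pD xp] xM].
    by exists p.
rewrite fsbig_finite/=; last exact: finite_finset.
apply: (@le_trans _ _ (\sum_(p <- fset_set D) (6 * M * t)%:E)%E).
  rewrite big_seq [X in (_ <= X)%E]big_seq; apply: lee_sum => p.
  rewrite in_fset_set; last exact: finite_finset.
  move=> /set_mem /= pD; apply: strip_area => //.
  rewrite lt_def enorm_ge0 andbT; apply/eqP => /enorm_eq0/eqP.
  by rewrite subr_eq0 => /eqP /cinj /eqP; rewrite (negbTE pD).
rewrite sumEFin lee_fin big_const_seq count_predT iter_addr_0 -[leLHS]mulr_natl.
rewrite ler_wpM2r ?mulr_ge0//.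
rewrite -natrX ler_nat.
have : (size (fset_set D) <= size (enum {: 'I_k * 'I_k}))%N.
  by apply: uniq_leq_size (fset_uniq _) _ => p _; rewrite mem_enum.
by rewrite -cardE card_prod card_ord.
Qed.

Lemma frontier_thickening_mass_le (c : codebook R k) t d : 0 <= t -> 0 <= d -> injective c ->
  (forall y i, ethickening (frontier c) t y -> d <= enorm (y - m i)) ->
  (P (ethickening (frontier c) t) <=
   (far_density_bound d * (k%:R ^+ 2 * (6 * M * t)))%:E)%E.
Proof.
move=> t0 d0 cinj far.
have mT : measurable (ethickening (frontier c) t).
  by apply: measurable_ethickening; exact: closed_frontier.
set K := far_density_bound d.
have K0 : 0 <= K.
  apply: mulr_ge0; first by rewrite invr_ge0 ltW.
  apply: mulr_ge0; last exact: expR_ge0.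
  by rewrite invr_ge0 mulr_ge0 ?sqr_ge0// mulr_ge0 ?pi_ge0.
rewrite P_density//.
apply: (@le_trans _ _ (\int[lebesgue2]_(x in ethickening (frontier c) t)
    (K%:E * (\1_(eball (0 : plane R) M) x)%:E))%E).
  apply: ge0_le_integral => //.
  - by move=> x _; rewrite lee_fin mixture_density_ge0.
  - apply/measurable_EFinP; apply: measurable_funTS; exact: measurable_mixture_density.
  - apply/measurable_EFinP; apply: measurable_funTS; apply: measurable_funM => //.
    exact: measurable_eball_indic.
  - by move=> x xT; rewrite -EFinM lee_fin mixture_density_le// => i; exact: far.
rewrite ge0_integralZl//; last first.
  apply/measurable_EFinP; apply: measurable_funTS; exact: measurable_eball_indic.
rewrite integral_indic//; last exact: measurable_eball.
by rewrite [leRHS]EFinM lee_wpmul2l ?lee_fin// setIC frontier_thickening_area.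
Qed.

End mixture_bounds.

(** * Separation of the means and numerical bounds *)

Section mean_separation.
Context {R : realType} {k : nat}.
Variable m : 'I_k -> plane R.

Lemma mean_separation_le i j : i != j -> mean_separation m <= enorm (m i - m j).
Proof.
move=> ij; apply: ge_inf; last by exists i, j.
by exists 0 => _ [a [b [_ ->]]]; exact: enorm_ge0.
Qed.

Lemma mean_separation_gt0 : (2 <= k)%N -> injective m -> 0 < mean_separation m.
Proof.
move=> k2 minj.
pose p0 := (Ordinal (ltnW k2), Ordinal k2).
have p0P : p0.1 != p0.2 by [].
case: (@arg_minP _ _ _ p0 (fun p => p.1 != p.2)
  (fun p : 'I_k * 'I_k => enorm (m p.1 - m p.2)) p0P) => p pP pmin.
apply: (@lt_le_trans _ _ (enorm (m p.1 - m p.2))).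
  rewrite lt_def enorm_ge0 andbT; apply/eqP => /enorm_eq0/eqP.
  by rewrite subr_eq0 => /eqP /minj /eqP; rewrite (negbTE pP).
apply: lb_le_inf; first by exists (enorm (m p0.1 - m p0.2)), p0.1, p0.2.
by move=> _ [i [j [ij ->]]]; exact: (pmin (i, j)).
Qed.

End mean_separation.

Section numerical_bounds.
Context {R : realType}.
Implicit Types x kk : R.

(** By repeated squaring, starting with [1 + 1 / 16 <= expR (1 / 16)]; the value [5 / 13]
    is what the comparison of risks below requires. *)
Lemma expRN1_le : expR (-1) <= 5 / 13 :> R.
Proof.
have dbl x y z : 0 <= z -> z <= expR x -> y <= z ^+ 2 -> y <= expR (x *+ 2).
  move=> z0 zx /le_trans; apply; rewrite -[x *+ 2]mulr_natl expRM_natl.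
  by rewrite ler_pXn2r// nnegrE ?expR_ge0.
have e1 : 17 / 16 <= expR (1 / 16) :> R by have := @expR_ge1Dx R (1 / 16); lra.
have e2 : 44 / 39 <= expR (1 / 16 *+ 2) :> R by apply: dbl e1 _; lra.
have e3 : 14 / 11 <= expR (1 / 16 *+ 2 *+ 2) :> R by apply: dbl e2 _; lra.
have e4 : 21 / 13 <= expR (1 / 16 *+ 2 *+ 2 *+ 2) :> R by apply: dbl e3 _; lra.
have : 13 / 5 <= expR (1 / 16 *+ 2 *+ 2 *+ 2 *+ 2) :> R by apply: dbl e4 _; lra.
have -> : 1 / 16 *+ 2 *+ 2 *+ 2 *+ 2 = 1 :> R by lra.
move=> e; rewrite expRN (_ : 5 / 13 = (13 / 5)^-1); last by rewrite invf_div.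
by rewrite lef_pV2 //; [exact: expR_gt0|rewrite qualifE /= divr_gt0].
Qed.

Lemma expR_ge_sqr x : 0 <= x -> (1 + x / 2) ^+ 2 <= expR x.
Proof.
move=> x0; have -> : expR x = expR (x / 2) ^+ 2.
  by rewrite -expRM_natl; congr expR; lra.
rewrite ler_pXn2r// ?nnegrE ?expR_ge0//; last by lra.
exact: expR_ge1Dx.
Qed.

End numerical_bounds.

(** * Consequences of the assumption on the weights *)

(** The two halves of the assumption on the weights, cleared of denominators; the factors
    [a] and [b] stand for the exponential ones. *)
Lemma max_ratio_le (R : realType) (C K B N M sigma q t1 t2 a b : R) :
  0 < C -> 0 < B -> 0 < N -> 0 < sigma -> 0 < a -> 0 < b -> 0 < t2 -> 0 <= K ->
  C * K / (N * B) * Num.max (sigma ^+ 2 / (B * a)) (K * M ^+ 3 / (q * sigma ^+ 2 * b))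
    <= t1 / t2 -> 0 < q ->
  K * t2 <= t1 * N * (B ^+ 2 / (C * sigma ^+ 2) * a) /\
  C * K ^+ 2 * M ^+ 3 * t2 <= q * t1 * N * B * sigma ^+ 2 * b.
Proof.
move=> C0 B0 N0 s0 a0 b0 t20 K0 h q0.
have c0 : 0 <= C * K / (N * B) by rewrite divr_ge0 ?mulr_ge0// ltW.
have s20 : 0 < sigma ^+ 2 by exact: exprn_gt0.
split.
  have : C * K / (N * B) * (sigma ^+ 2 / (B * a)) <= t1 / t2.
    by apply: le_trans h; apply: ler_wpM2l => //; rewrite le_max lexx.
  rewrite mulf_div ler_pdivrMr ?mulr_gt0// [leRHS]mulrAC ler_pdivlMr// => h1.
  have -> : t1 * N * (B ^+ 2 / (C * sigma ^+ 2) * a) =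
      t1 * (N * B * (B * a)) / (C * sigma ^+ 2) by field; rewrite !gt_eqF.
  rewrite ler_pdivlMr ?mulr_gt0//; apply: le_trans h1.
  by rewrite le_eqVlt; apply/orP; left; apply/eqP; ring.
have : C * K / (N * B) * (K * M ^+ 3 / (q * sigma ^+ 2 * b)) <= t1 / t2.
  by apply: le_trans h; apply: ler_wpM2l => //; rewrite le_max lexx orbT.
rewrite mulf_div ler_pdivrMr ?mulr_gt0// [leRHS]mulrAC ler_pdivlMr// => h1.
have -> : C * K ^+ 2 * M ^+ 3 * t2 = C * K * (K * M ^+ 3) * t2 by ring.
by apply: le_trans h1 _; rewrite le_eqVlt; apply/orP; left; apply/eqP; ring.
Qed.

(* [K] is the number of components and [N] the least truncation mass *)
Section ratio_consequences.
Context {R : realType}.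
Variables (K beta N M sigma tmin tmax : R).
Hypotheses (K_ge2 : 2 <= K) (beta_gt0 : 0 < beta) (N_gt0 : 0 < N) (N_le1 : N <= 1).
Hypotheses (M_gt0 : 0 < M) (sigma_gt0 : 0 < sigma).
Hypotheses (tmin_ge0 : 0 <= tmin) (tmin_le : tmin <= tmax) (tmax_ge : 1 <= K * tmax).
Let kap := beta ^+ 2 / (2 * sigma ^+ 2).
Hypothesis ratio_separation : K * tmax <= tmin * N * (kap * (1 - expR (- kap))).
Hypothesis ratio_tail :
  64 * K ^+ 2 * M ^+ 3 * tmax <= 7 * tmin * N * beta * sigma ^+ 2 * (expR (64 * kap) - 1).

Let sigma2_gt0 : 0 < sigma ^+ 2. Proof. exact: exprn_gt0. Qed.
Let K_gt0 : 0 < K. Proof. exact: lt_le_trans K_ge2. Qed.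
Let tmax_gt0 : 0 < tmax. Proof. by rewrite -(pmulr_rgt0 _ K_gt0); exact: lt_le_trans tmax_ge. Qed.
Let kap_gt0 : 0 < kap. Proof. by rewrite divr_gt0 ?exprn_gt0// mulr_gt0. Qed.
Let e1_gt0 : 0 < 1 - expR (- kap).
Proof. by rewrite subr_gt0 -[ltRHS]expR0 ltr_expR oppr_lt0. Qed.
Let beta2E : beta ^+ 2 = 2 * sigma ^+ 2 * kap.
Proof. by rewrite /kap mulrC divfK// gt_eqF// mulr_gt0. Qed.

Lemma min_weight_gt0 : 0 < tmin.
Proof.
rewrite lt_def tmin_ge0 andbT; apply/eqP => t0; have := ratio_separation.
by rewrite t0 !mul0r => /(le_trans tmax_ge); rewrite ler10.
Qed.

(** Since [tmin <= tmax], the lower bound on the ratio of the weights forces the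
    means to be far apart with respect to [sigma]. *)
Lemma separation_ratio_ge : K <= kap.
Proof.
rewrite -(ler_pM2r tmax_gt0); apply: le_trans ratio_separation _.
rewrite mulrC; apply: ler_pM.
- by rewrite mulr_ge0// ltW.
- by rewrite mulr_ge0// ltW.
- by rewrite ler_piMr ?(ltW kap_gt0)//; have := expR_gt0 (- kap); lra.
- by rewrite -[leRHS]mulr1; apply: ler_pM => //; exact: ltW.
Qed.

(** The radius [17 / 24 * beta] gives an exponent [kap * (17 / 24) ^+ 2 >= 1] because
    [kap >= 2]; then [119 / 60] satisfies [(119 / 60 - 17 / 24) ^+ 2 * (1 - 5 / 13) >= 1]. *)
Lemma missed_mean_gt th : tmin <= th ->
  2 * sigma ^+ 2 / N < (119 / 60 * beta - 17 / 24 * beta) ^+ 2 *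
    (th * (1 - expR (- ((17 / 24 * beta) ^+ 2 / (2 * sigma ^+ 2))))).
Proof.
move=> tth.
have -> : (17 / 24 * beta) ^+ 2 / (2 * sigma ^+ 2) = (17 / 24) ^+ 2 * kap.
  by rewrite exprMn -[LHS]mulrA.
have -> : (119 / 60 * beta - 17 / 24 * beta) ^+ 2 = (51 / 40) ^+ 2 * beta ^+ 2.
  by rewrite -exprMn; congr (_ ^+ 2); lra.
have e1 : expR (- ((17 / 24) ^+ 2 * kap)) <= 5 / 13.
  by apply: le_trans expRN1_le; rewrite ler_expR; have := separation_ratio_ge; have := K_ge2; lra.
have t0 := min_weight_gt0.
apply: (@lt_le_trans _ _ (beta ^+ 2 * tmin)); last first.
  rewrite -[leRHS]mulrA [leRHS]mulrCA; apply: ler_wpM2l; first exact: sqr_ge0.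
  have h : 8 / 13 * tmin <= th * (1 - expR (- ((17 / 24) ^+ 2 * kap))).
    rewrite mulrC; apply: ler_pM; lra.
  lra.
rewrite ltr_pdivrMr// beta2E.
have h : 1 < tmin * N * kap.
  have : tmin * N * (kap * (1 - expR (- kap))) < tmin * N * kap.
    rewrite ltr_pM2l ?mulr_gt0//; rewrite gtr_pMr//.
    by have := expR_gt0 (- kap); lra.
  have := ratio_separation; have := tmax_ge; lra.
have -> : 2 * sigma ^+ 2 * kap * tmin * N = 2 * sigma ^+ 2 * (tmin * N * kap) by ring.
by rewrite ltr_pMr// mulr_gt0.
Qed.

(** The excess of [241 / 30] over [8] gains the factor [expR (- kap / 2)], which absorbs
    the factor [K] lost by summing over pairs of cells. *)
Lemma frontier_bound_le_margin t : 0 <= t ->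
  far_density_bound sigma N (241 / 30 * beta) * (K ^+ 2 * (6 * M * t)) <=
  28 * beta * (tmin * (1 - expR (- (64 * kap)))) * ((128 * M ^+ 2)^-1 * t).
Proof.
move=> t0; rewrite /far_density_bound.
have -> : (241 / 30 * beta) ^+ 2 / (2 * sigma ^+ 2) = (241 / 30) ^+ 2 * kap.
  by rewrite exprMn -[LHS]mulrA.
set e := expR (- (64 * kap)); set e' := expR (- ((241 / 30) ^+ 2 * kap)).
have e0 : 0 < e by exact: expR_gt0.
have ee' : 3 * K * e' <= 4 * e.
  have : e' <= e * expR (- (K / 2)).
    by rewrite /e /e' -expRD ler_expR; have := separation_ratio_ge; have := K_ge2; lra.
  rewrite expRN => h.
  apply: (@le_trans _ _ (3 * K * (e * (expR (K / 2))^-1))).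
    by rewrite ler_wpM2l// mulr_ge0// ltW.
  rewrite mulrA ler_pdivrMr ?expR_gt0// [leRHS]mulrAC ler_pM2r//.
  have : (1 + K / 2 / 2) ^+ 2 <= expR (K / 2) by apply: expR_ge_sqr; have := K_ge2; lra.
  have := sqr_ge0 (K - 2); lra.
have tail : 64 * K ^+ 2 * M ^+ 3 * tmax * e <=
    7 * tmin * N * beta * sigma ^+ 2 * (1 - e).
  have -> : 1 - e = (expR (64 * kap) - 1) * e.
    by rewrite mulrBl mul1r /e -expRD subrr expR0.
  by rewrite [leRHS]mulrA ler_pM2r// ratio_tail.
have pi2 := @pi_ge2 R; have pi0 := @pi_gt0 R.
have M2 : 0 < M ^+ 2 by exact: exprn_gt0.
have -> : N^-1 * ((2 * pi * sigma ^+ 2)^-1 * e') * (K ^+ 2 * (6 * M * t)) =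
    (K * M * (3 * K * e') / (N * sigma ^+ 2 * pi)) * t.
  by clear pi2; move: (@pi R) pi0 => p p0; field; rewrite !gt_eqF.
have -> : 28 * beta * (tmin * (1 - e)) * ((128 * M ^+ 2)^-1 * t) =
    (7 * beta * tmin * (1 - e) / (32 * M ^+ 2)) * t.
  by field; rewrite gt_eqF.
apply: ler_wpM2r => //.
apply: (@le_trans _ _ (2 * K * M * e / (N * sigma ^+ 2))).
  rewrite ler_pdivrMr ?mulr_gt0//.
  rewrite (_ : _ * (N * sigma ^+ 2 * pi) = K * M * (2 * e * pi)); last first.
    by move: (@pi R) => p; field; rewrite !gt_eqF.
  rewrite ler_pM2l ?mulr_gt0//; apply: le_trans ee' _.
  by have := ler_wpM2l (ltW e0) pi2; lra.
rewrite ler_pdivrMr ?mulr_gt0// [leRHS]mulrAC ler_pdivlMr ?mulr_gt0//.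
have : 64 * K * M ^+ 3 * e * 1 <= 64 * K * M ^+ 3 * e * (K * tmax).
  by rewrite ler_wpM2l// !mulr_ge0 ?exprn_ge0 ?(ltW M_gt0)// ltW.
lra.
Qed.

End ratio_consequences.

(** * The margin condition *)

Theorem proposition3p2 (R : realType) (k : nat) (M sigma : R)
    (m : 'I_k -> plane R) (theta : 'I_k -> R) (P : probability (plane R) R)
    (eta := truncation_loss M sigma m)
    (B := mean_separation m)
    (theta_min := inf (range theta))
    (theta_max := sup (range theta))
    (k_ge2 : (2 <= k)%N) (M_gt0 : 0 < M) (sigma_gt0 : 0 < sigma)
    (m_distinct : injective m)
    (theta_ge0 : forall i, 0 <= theta i) (theta_sum : \sum_(i < k) theta i = 1)
    (P_density : has_density P (mixture_density M sigma m theta))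
    (balls_sub : forall i, eball (m i) (B / 3) `<=` eball 0 M)
    (weights_ratio :
      2048 * k%:R / ((1 - eta) * B)
        * Num.max
            (sigma ^+ 2
               / (B * (1 - expR (- (B ^+ 2 / (2048 * sigma ^+ 2))))))
            (k%:R * M ^+ 3
               / (7 * sigma ^+ 2 * (expR (B ^+ 2 / (32 * sigma ^+ 2)) - 1)))
      <= theta_min / theta_max) :
  margin_condition k P M (B / 8).
Proof.
have k_gt0 : (0 < k)%N by exact: ltnW.
have M_ge0 : 0 <= M by exact: ltW.
have K2 : 2 <= k%:R :> R by rewrite (ler_nat _ 2).
have B_gt0 : 0 < B by exact: mean_separation_gt0.
have B_le i j : i != j -> B <= enorm (m i - m j) by exact: mean_separation_le.
have s2 : 0 < sigma ^+ 2 by exact: exprn_gt0.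
have tail_gt0 (x : R) : 0 < x -> 0 < 1 - expR (- (x ^+ 2 / (2 * sigma ^+ 2))).
  move=> x0; rewrite subr_gt0 -[ltRHS]expR0 ltr_expR oppr_lt0.
  by rewrite divr_gt0 ?mulr_gt0 ?exprn_gt0.
have m_in i : eball 0 M (m i).
  by apply: (balls_sub i); rewrite /eball /= subrr enorm0 divr_ge0 ?(ltW B_gt0).
pose N := inf (range (truncation_mass M sigma m)).
have etaN : 1 - eta = N by rewrite /eta /truncation_loss opprB addrC subrK.
have N_le i : N <= truncation_mass M sigma m i by exact: inf_range_le.
have B3 : 0 < B / 3 by exact: divr_gt0.
have N_gt0 : 0 < N.
  apply: lt_le_trans (tail_gt0 _ B3) _; apply: le_inf_range => // i.
  by apply: truncation_mass_ge => //; exact: ltW.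
have N_le1 : N <= 1.
  apply: le_trans (N_le (Ordinal k_gt0)) _.
  by apply: truncation_mass_le1 => //; exact: ltW.
have tmin_le i : theta_min <= theta i by exact: inf_range_le.
have tmin_ge0 : 0 <= theta_min by exact: le_inf_range.
have tmax_ge i : theta i <= theta_max by exact: le_sup_range.
have tmin_max : theta_min <= theta_max by exact: le_trans (tmax_ge (Ordinal k_gt0)).
have ktmax : 1 <= k%:R * theta_max.
  rewrite -[leLHS]theta_sum mulr_natl -[X in _ *+ X]card_ord -sumr_const.
  exact: ler_sum.
have tmax_gt0 : 0 < theta_max.
  have K0 : 0 < k%:R :> R by rewrite ltr0n.
  by rewrite -(pmulr_rgt0 _ K0) (lt_le_trans ltr01).
(* all the distances below are multiples of this one *)
pose beta := B / 32.
have BE : B = 32 * beta by rewrite /beta; lra.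
have beta_gt0 : 0 < beta by exact: divr_gt0.
have kapE : B ^+ 2 / (2048 * sigma ^+ 2) = beta ^+ 2 / (2 * sigma ^+ 2).
  by rewrite BE; field; rewrite gt_eqF.
have tailE : B ^+ 2 / (32 * sigma ^+ 2) = 64 * (beta ^+ 2 / (2 * sigma ^+ 2)).
  by rewrite BE; field; rewrite gt_eqF.
have e64_gt0 : 0 < expR (64 * (beta ^+ 2 / (2 * sigma ^+ 2))) - 1.
  rewrite subr_gt0 -[ltLHS]expR0 ltr_expR.
  by rewrite mulr_gt0 ?divr_gt0 ?mulr_gt0 ?exprn_gt0.
have C_gt0 : 0 < 2048 :> R by rewrite ltr0n.
move: weights_ratio; rewrite etaN kapE tailE => ratio.
have [] := max_ratio_le C_gt0 B_gt0 N_gt0 sigma_gt0 (tail_gt0 _ beta_gt0) e64_gt0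
  tmax_gt0 (ler0n _ k) ratio (ltr0Sn _ 6).
rewrite kapE => ratio_separation ratio_tail32.
have ratio_tail : 64 * k%:R ^+ 2 * M ^+ 3 * theta_max <=
    7 * theta_min * N * beta * sigma ^+ 2 *
    (expR (64 * (beta ^+ 2 / (2 * sigma ^+ 2))) - 1).
  rewrite -(ler_pM2l (ltr0Sn _ 31)); move: ratio_tail32; rewrite BE => h.
  rewrite [leLHS](_ : _ = 2048 * k%:R ^+ 2 * M ^+ 3 * theta_max); last by ring.
  apply: (le_trans h); rewrite le_eqVlt; apply/orP; left; apply/eqP; ring.
clear C_gt0 ratio ratio_tail32 kapE.
have missed := missed_mean_gt K2 beta_gt0 N_gt0 N_le1 sigma_gt0 tmin_ge0 tmin_max
  ktmax ratio_separation.
pose rho := 119 / 60 * beta.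
have ball_sub i r : r <= B / 3 -> eball (m i) r `<=` eball 0 M.
  move=> rB; apply: subset_trans (balls_sub i).
  by apply: subset_eball; rewrite subrr enorm0 subr_ge0.
(* otherwise [m] itself would be a better codebook *)
have near (c : codebook R k) i : optimal_codebooks P c ->
    exists j, enorm (c j - m i) <= rho.
  move=> copt; apply: contrapT => /forallNP far.
  have far' j : rho <= enorm (c j - m i).
    by have := far j; move=> /negP; rewrite -ltNge => /ltW.
  have := missed (theta i) (tmin_le i); rewrite ltNge => /negP; apply.
  rewrite -lee_fin; apply: le_trans (risk_means_le k_gt0 M_ge0 sigma_gt0
    theta_ge0 theta_sum m_in N_gt0 N_le P_density).
  apply: le_trans (copt m).
  apply: (risk_ge k_gt0 M_ge0 sigma_gt0 theta_ge0 m_in N_gt0 N_le P_density) => //.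
  - by rewrite /rho; apply/andP; split; lra.
  - by apply: ball_sub; rewrite BE; lra.
have matched (c : codebook R k) : optimal_codebooks P c -> exists tau : 'I_k -> 'I_k,
    (forall i, enorm (c (tau i) - m i) <= rho) /\ (forall j, exists i, j = tau i).
  move=> copt; have /choice[tau tauP] := fun i => near c i copt.
  exists tau; split => // j.
  have tau_inj : injective tau.
    move=> i h ih; apply/eqP/negPn/negP => /B_le.
    have := enorm_triangle (c (tau i)) (m i) (m h).
    have := tauP i; have := tauP h; rewrite -ih (enormC (m i) (c _)) /rho BE; lra.
  by exists (invF tau_inj j); rewrite f_invF.
have t_gt0 := min_weight_gt0 tmin_ge0 ktmax ratio_separation.
have sep_ge : ((28 * beta)%:E <= optimal_separation P (k := k))%E.
  apply: le_ereal_inf_tmp => _ [c [i [j [copt ij ->]]]].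
  have [tau [tauP tau_surj]] := matched c copt.
  rewrite lee_fin; apply: le_trans (matched_sep B_le tauP tau_surj ij).
  by rewrite /rho BE; lra.
have r4 : 64 * (beta ^+ 2 / (2 * sigma ^+ 2)) = (8 * beta) ^+ 2 / (2 * sigma ^+ 2).
  by field; rewrite gt_eqF.
have mass_ge : ((theta_min * (1 - expR (- (64 * (beta ^+ 2 / (2 * sigma ^+ 2))))))%:E
    <= min_cell_mass P (k := k))%E.
  apply: le_ereal_inf_tmp => _ [c [j [copt ->]]].
  have [tau [tauP tau_surj]] := matched c copt; have [i ->] := tau_surj j.
  apply: (@le_trans _ _ (P (eball (m i) (8 * beta)))).
    apply: (@le_trans _ _ (theta i * (1 - expR (- ((8 * beta) ^+ 2 / (2 * sigma ^+ 2)))))%:E).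
      by rewrite r4 lee_fin ler_wpM2r// ltW// tail_gt0// mulr_gt0.
    apply: (mixture_mass_eball_ge M_ge0 sigma_gt0 theta_ge0 m_in N_gt0 N_le P_density).
    - by rewrite mulr_ge0// ltW.
    - by apply: ball_sub; rewrite BE; lra.
  apply: le_measure.
  - by apply/mem_set; exact: measurable_eball.
  - by apply/mem_set; apply: closed_measurable_plane; exact: closed_voronoi.
  - by apply: (matched_voronoi B_le tauP tau_surj); rewrite /rho BE; lra.
split; first exact: divr_gt0.
  exact: mixture_bounded P_density.
move=> t /andP[t0 tB].
have frontier_le : (frontier_mass P (k := k) t <= (far_density_bound sigma N (241 / 30 * beta) *
    (k%:R ^+ 2 * (6 * M * t)))%:E)%E.
  apply: ge_ereal_sup => _ [c copt <-].
  have [tau [tauP tau_surj]] := matched c copt.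
  apply: (frontier_thickening_mass_le M_ge0 sigma_gt0 theta_ge0 theta_sum
    N_gt0 N_le P_density) => //.
  - by rewrite mulr_ge0// ltW.
  - move=> i j cij; apply/eqP/negPn/negP => ij.
    have := matched_sep B_le tauP tau_surj ij.
    by rewrite cij subrr enorm0 /rho BE; lra.
  - move=> y i /(matched_frontier_far B_le tauP tau_surj) => /(_ i).
    by apply: le_trans; move: tB; rewrite /rho BE; lra.
apply: (le_trans frontier_le).
apply: (@le_trans _ _ (((28 * beta)%:E *
    (theta_min * (1 - expR (- (64 * (beta ^+ 2 / (2 * sigma ^+ 2))))))%:E) *
    ((128 * M ^+ 2)^-1 * t)%:E)%E).
  rewrite -!EFinM lee_fin.
  exact: (frontier_bound_le_margin K2 beta_gt0 N_gt0 N_le1 M_gt0 sigma_gt0 tmin_ge0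
    tmin_max ktmax ratio_separation ratio_tail).
have e0 : 0 <= 1 - expR (- (64 * (beta ^+ 2 / (2 * sigma ^+ 2)))).
  by rewrite r4 ltW// tail_gt0// mulr_gt0.
apply: lee_wpmul2r.
  by rewrite lee_fin mulr_ge0// invr_ge0 mulr_ge0// sqr_ge0.
apply: lee_pmul => //; rewrite lee_fin mulr_ge0//.
exact: ltW.
Qed.
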